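(* Let $a>b>0$, $\sigma>0$, and consider the billiard within the ellipse $\mathcal{E}: \frac{x^2}{a}+\frac{y^2}{b}=1$ in the Hooke potential $\frac{\sigma}{2}(x^2+y^2)$. The critical periodic billiard trajectories along the $y$-axis and the limit periodic trajectories along the ellipse $\mathcal{E}$ are stable, while the critical periodic trajectories along the $x$-axis are unstable.
   Context: Dynamics. A particle of unit mass moves in the closed region bounded by $\mathcal{E}$ in the potential field $\frac{\sigma}{2}(x^2+y^2)$ and is reflected elastically at $\mathcal{E}$ (the velocity component tangent to $\mathcal{E}$ is kept, the normal component changes sign). Phase space: $\mathcal{M}=\{(\xi,v): \xi \text{ is within }\mathcal{E},\ v\in T_\xi\mathbf{R}^2\}/\sim$, where distinct pairs $(\xi,v_1)\sim(\xi,v_2)$ are identified iff $\xi\in\mathcal{E}$, $v_1+v_2\in T_\xi\mathcal{E}$ and $v_1-v_2\perp T_\xi\mathcal{E}$. Write $\xi=(\xi_1,\xi_2)$, $v=(v_1,v_2)$, $\xi^2=\xi_1^2+\xi_2^2$, $v^2=v_1^2+v_2^2$. Integrals. The energy is $E(\xi,v)=\frac{v^2}{2}+\frac{\sigma\xi^2}{2}$, and the polynomial $$p(\lambda)=(v_2\xi_1-v_1\xi_2)^2-(b-\lambda)v_1^2-(a-\lambda)v_2^2-\sigma\big((b-\lambda)\xi_1^2+(a-\lambda)\xi_2^2\big)+\sigma(a-\lambda)(b-\lambda)$$ is constant along trajectories; denote its roots by $\lambda_1\le\lambda_2$. The system is considered on $\mathcal{M}_B=\{(\xi,v)\in\mathcal{M}: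 p(0)\le0\}$, i.e. on the points of trajectories that meet $\mathcal{E}$. Trajectories in question. The critical trajectories along the $y$-axis are those moving on the $y$-axis; they have $\lambda_2=a$ and energy $E\ge\frac{\sigma b}{2}$. The critical trajectories along the $x$-axis are those moving on the $x$-axis; they have $\lambda_2=b$ and energy $E\ge\frac{\sigma a}{2}$. The limit trajectories along $\mathcal{E}$ have $\lambda_2=0$ and energy $E\ge\frac{\sigma(a+b)}{2}$: they are the motions along $\mathcal{E}$ itself, in either direction, with velocity tangent to $\mathcal{E}$ and $v^2=2E-\sigma\xi^2$, obtained as limits of billiard trajectories whose inner caustic tends to $\mathcal{E}$. Stability is orbital Lyapunov stability: a periodic orbit $\gamma$ is stable if for every neighbourhood $U$ of $\gamma$ in $\mathcal{M}_B$ there is a neighbourhood $V$ of $\gamma$ in $\mathcal{M}_B$ such that every trajectory starting in $V$ stays in $U$ for all later times; it is unstable otherwise. *)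

(* Defs.v *)
From HB Require Import structures.
From mathcomp Require Import all_boot all_order all_algebra.
From mathcomp Require Import all_classical all_reals all_analysis.
From mathcomp Require Import ring lra.

Set Implicit Arguments.
Unset Strict Implicit.
Unset Printing Implicit Defensive.

Import Order.TTheory GRing.Theory Num.Theory.
Import numFieldNormedType.Exports.

Local Open Scope classical_set_scope.
Local Open Scope quotient_scope.
Local Open Scope ring_scope.

Section hooke_billiard.
Context {R : realType}.
Implicit Types (a b sigma e t lam : R) (x v w : (R * R)%type).

Definition dot v w : R := v.1 * w.1 + v.2 * w.2.

Definition on_ellipse a b x : Prop := x.1 ^+ 2 / a + x.2 ^+ 2 / b = 1.

(* the tangent line to the ellipse at its point x, as a linear subspace *)
Definition tangent a b x v : Prop := x.1 * v.1 / a + x.2 * v.2 / b = 0.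

(* v and w have the same tangential and opposite normal components at x *)
Definition reflected a b x v w : Prop :=
  tangent a b x (v + w) /\ forall u, tangent a b x u -> dot (v - w) u = 0.

Definition inside a b : set ((R * R) * (R * R)) :=
  [set z | z.1.1 ^+ 2 / a + z.1.2 ^+ 2 / b <= 1].

(* Pairs (position, velocity), with the subset topology inherited from R^4. *)
Definition state a b := set_type (inside a b).

Definition pos a b (z : state a b) : (R * R)%type := (set_val z).1.
Definition vel a b (z : state a b) : (R * R)%type := (set_val z).2.

Definition same_phase a b (z1 z2 : state a b) : Prop :=
  z1 = z2 \/
  [/\ pos z1 = pos z2, on_ellipse a b (pos z1) &
      reflected a b (pos z1) (vel z1) (vel z2)].

Definition same_phaseb a b : rel (state a b) :=
  fun z1 z2 => `[< same_phase z1 z2 >].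

Lemma reflected_sym a b x v w : reflected a b x v w -> reflected a b x w v.
Proof.
case: v w => [v1 v2] [w1 w2] [vw1 vw2]; split=> [|u /vw2].
  by rewrite addrC.
by rewrite /dot /= -[v1 - w1]opprB -[v2 - w2]opprB => h; lra.
Qed.

Lemma reflected_inj a b x u v w : on_ellipse a b x ->
  reflected a b x u v -> reflected a b x v w -> u = w.
Proof.
case: x u v w => [x1 x2] [u1 u2] [v1 v2] [w1 w2].
rewrite /on_ellipse /= => xE [uv uvN] [vw vwN].
have tau : tangent a b (x1, x2) (- (x2 / b), x1 / a).
  by rewrite /tangent /=; ring.
move: uv vw (uvN _ tau) (vwN _ tau) xE => {tau uvN vwN}.
rewrite /tangent /dot /= ![x1 * _ / a]mulrAC ![x2 * _ / b]mulrAC.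
move: (x1 / a) (x2 / b) => m n uv vw uvN vwN xE.
have du : m * (u1 - w1) + n * (u2 - w2) = 0 by lra.
have dw : m * (u2 - w2) - n * (u1 - w1) = 0 by lra.
have mn : m ^+ 2 + n ^+ 2 != 0.
  rewrite paddr_eq0 ?sqr_ge0// !sqrf_eq0; apply/negP => /andP[/eqP m0 /eqP n0].
  by move: xE; rewrite m0 n0; lra.
have d1 : u1 - w1 = 0.
  apply: (mulfI mn); rewrite mulr0.
  by transitivity (m * 0 - n * 0 : R); [rewrite -{1}du -dw; ring|ring].
have d2 : u2 - w2 = 0.
  apply: (mulfI mn); rewrite mulr0.
  by transitivity (n * 0 + m * 0 : R); [rewrite -{1}du -dw; ring|ring].
by rewrite (subr0_eq d1) (subr0_eq d2).
Qed.

Lemma same_phaseb_refl a b : reflexive (@same_phaseb a b).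
Proof. by move=> z; apply/asboolP; left. Qed.

Lemma same_phaseb_sym a b : symmetric (@same_phaseb a b).
Proof.
have h (z1 z2 : state a b) : same_phase z1 z2 -> same_phase z2 z1.
  case=> [->|[p12 e1 r12]]; [by left|right].
  by rewrite -p12; split=> //; exact: reflected_sym.
by move=> z1 z2; apply/asboolP/asboolP; exact: h.
Qed.

Lemma same_phaseb_trans a b : transitive (@same_phaseb a b).
Proof.
move=> z2 z1 z3 /asboolP h12 /asboolP h23; apply/asboolP.
case: h12 => [-> //|[p12 e1 r12]].
case: h23 => [<-|[p23 e2 r23]]; first by right.
have v13 : vel z1 = vel z3 by apply: (reflected_inj e1 r12); rewrite p12.
left; apply: val_inj; rewrite [LHS]surjective_pairing [RHS]surjective_pairing.
by move: p12 v13; rewrite p23 /pos /vel set_valE => -> ->.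
Qed.

Definition same_phase_equiv a b : equiv_rel (state a b) :=
  EquivRel (@same_phaseb a b) (@same_phaseb_refl a b)
    (@same_phaseb_sym a b) (@same_phaseb_trans a b).

Definition phase_space a b := quotient_topology {eq_quot same_phase_equiv a b}.

Definition phase a b (z : state a b) : phase_space a b := \pi z.

Definition energy sigma a b (z : state a b) : R :=
  dot (vel z) (vel z) / 2 + sigma * dot (pos z) (pos z) / 2.

Definition p_integral sigma a b (z : state a b) lam : R :=
  let: (x1, x2) := pos z in let: (v1, v2) := vel z in
  (v2 * x1 - v1 * x2) ^+ 2 - (b - lam) * v1 ^+ 2 - (a - lam) * v2 ^+ 2
  - sigma * ((b - lam) * x1 ^+ 2 + (a - lam) * x2 ^+ 2)
  + sigma * (a - lam) * (b - lam).

Definition M_B sigma a b : set (phase_space a b) :=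
  @phase a b @` [set z | p_integral sigma z 0 <= 0].
Arguments M_B sigma {a b}.

(* Motions are parametrised by t >= 0; the values at t < 0 are irrelevant.
   At an impact time, vel (z t) is the outgoing velocity and the limit of the
   velocity from the left is the incoming one.  Touching the ellipse
   tangentially (or with zero velocity) counts as an impact, at which the
   reflection law just says that the velocity is continuous. *)
Definition billiard_motion sigma a b (z : R -> state a b) : Prop :=
  let x := fun t => pos (z t) in let v := fun t => vel (z t) in
  [/\ {within `[0, +oo[, continuous x},
      forall t, 0 <= t -> v s @[s --> t^'+] --> v t,
      forall t, 0 < t -> ~ on_ellipse a b (x t) ->
        is_derive t 1 x (v t) /\ is_derive t 1 v (- sigma *: x t),
      forall t, 0 < t -> on_ellipse a b (x t) ->
        exists2 w, v s @[s --> t^'-] --> w & reflected a b (x t) w (v t) &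
      forall T : R, finite_set [set t | 0 <= t <= T /\ on_ellipse a b (x t)]].

Definition limit_motion sigma a b e (z : R -> state a b) : Prop :=
  let x := fun t => pos (z t) in let v := fun t => vel (z t) in
  [/\ sigma * (a + b) / 2 <= e,
      {within `[0, +oo[, continuous x} /\ {within `[0, +oo[, continuous v},
      forall t, 0 < t -> is_derive t 1 x (v t) &
      forall t, 0 <= t -> [/\ on_ellipse a b (x t), tangent a b (x t) (v t) &
        dot (v t) (v t) = 2 * e - sigma * dot (x t) (x t)]].

(* The limit motions are needed for a complete dynamics on M_B: they start at
   the boundary states with tangential velocity from which free motion does not
   enter the interior of the table. *)
Definition motion sigma a b (z : R -> state a b) : Prop :=
  billiard_motion sigma z \/ exists e, limit_motion sigma e z.

Definition y_axis_motion sigma a b e (z : R -> state a b) : Prop :=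
  [/\ billiard_motion sigma z, energy sigma (z 0) = e, sigma * b / 2 <= e &
      forall t, 0 <= t -> (pos (z t)).1 = 0].

Definition x_axis_motion sigma a b e (z : R -> state a b) : Prop :=
  [/\ billiard_motion sigma z, energy sigma (z 0) = e, sigma * a / 2 <= e &
      forall t, 0 <= t -> (pos (z t)).2 = 0].

Definition phase_orbit a b (z : R -> state a b) : set (phase_space a b) :=
  [set phase (z t) | t in `[0, +oo[].

(* N contains the trace on M_B of a neighbourhood of g in the phase space *)
Definition nbhs_in_M_B sigma a b (g N : set (phase_space a b)) : Prop :=
  N `<=` M_B sigma /\ within (M_B sigma) (set_nbhs g) N.

Definition orbitally_stable sigma a b (g : set (phase_space a b)) : Prop :=
  forall U, nbhs_in_M_B sigma g U ->
  exists2 V, nbhs_in_M_B sigma g V &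
    forall z : R -> state a b, motion sigma z -> V (phase (z 0)) ->
      forall t, 0 <= t -> U (phase (z t)).

End hooke_billiard.

(* Main.v *)
Require Import Defs.
From mathcomp Require Import all_boot all_order all_algebra.
From mathcomp Require Import all_classical all_reals all_analysis.
From mathcomp Require Import ring lra.

(** Energy [E] and the polynomial [p] are continuous functions on the phase
space, kept by free motion and by reflections.  Stability comes from using
them as Lyapunov functions.

- Along the y-axis: [p(a) = L^2 + (a - b) (v1^2 + sigma x1^2)], with [L] the
  angular momentum, is nonnegative and vanishes only if [x1 = v1 = 0].  Hence
  [p(a) + |E - e|] vanishes exactly on the axial states of energy [e].
- Along the ellipse: on [M_B] the function [- p(0) + |E - e|] is nonnegative.
  When [e >= sigma (a + b) / 2] it vanishes exactly on the states of energy
  [e] at the ellipse with tangential velocity ([limit_level]).  These form two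
  closed curves, one for each orientation.  The tangential velocity component
  is continuous across reflections and vanishes on neither curve, so a motion
  near one of them cannot change sides.

Compactness of the sublevel sets of [E] turns these facts into orbital
stability ([orbital_stability_criterion]), provided that the orbit fills the
zero set, or the curve of its orientation ([axis_visits], [limit_visits]).  If
a motion missed a point of this closed curve, its angle from that point would
have a well-defined half, the arc tangent of a stereographic coordinate.  This
bounded quantity would decrease at a positive rate forever
([atan_decay_absurd]).

For the x-axis, write a state as [(x, q)] with [q = v / sqrt sigma], so that
free motion is a rotation in the planes [(x_i, q_i)].  Since
[p(0) = - a b (n . v)^2] on the ellipse, where [n = (x1 / a, x2 / b)], the
outgoing normal part [n . q = - m] is the same after all bounces, and the time
to the next bounce is explicit.  Start at the vertex [(sqrt a, 0)] with a
velocity slightly tilted downwards.  Up to the central symmetry, which is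
applied at every bounce, the impact point stays in the first quadrant as long
as it is close to the axis, and it moves away from the axis by a turn bounded
below in terms of [m] and [L].  Meanwhile each reflection makes [L] more
negative, so the turns do not die out and the motion leaves a fixed
neighbourhood of the axis ([tilted_escape]).  Arbitrarily small tilts start
arbitrarily close to the orbit on the axis.  To conclude, such motions have to
exist for all times: flights are glued at the impact times, which do not
accumulate because flight times are bounded below ([bouncing_motion]). *)

Set Implicit Arguments.
Unset Strict Implicit.
Unset Printing Implicit Defensive.

Import Order.TTheory GRing.Theory Num.Theory.
Import numFieldNormedType.Exports.

Local Open Scope classical_set_scope.
Local Open Scope ring_scope.


(** * Monotonicity with finitely many exceptional times *)

Section calculus.
Context {R : realType}.
Implicit Types (f g : R -> R) (a b c t : R).

Lemma nonincreasing_between f a b : a <= b ->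
  (forall t, a <= t < b -> f x @[x --> t^'+] --> f t) ->
  (forall t, a < t <= b -> exists2 l, f x @[x --> t^'-] --> l & f t <= l) ->
  (forall t, a < t < b -> exists2 d, is_derive t 1 f d & d <= 0) ->
  f b <= f a.
Proof.
rewrite le_eqVlt => /predU1P[->//|ab] fr fl fd.
have [l fbl lb] : exists2 l, f x @[x --> b^'-] --> l & f b <= l.
  by apply: fl; rewrite ab lexx.
apply: (le_trans lb); apply: (cvgr_to_le fbl).
near=> x.
have ax : a < x by near: x; apply: nbhs_left_gt.
have xb : x < b by near: x; apply: nbhs_left_lt.
have fder t : t \in `]a, x[ -> exists2 d, is_derive t 1 f d & d <= 0.
  rewrite in_itv/= => /andP[at_ tx]; apply: fd; rewrite at_/=.
  exact: lt_trans xb.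
have fcont t : a < t < b -> {for t, continuous f}.
  move=> /fd[d fd' _]; apply: differentiable_continuous.
  by apply/derivable1_diffP; case: fd'.
apply: (@ler0_derive1_le_cc R f a x); rewrite ?in_itv/= ?lexx ?(ltW ax)//.
- by move=> t /fder[d [] ].
- by move=> t /fder[d fd' d0]; rewrite derive1E; case: fd' => _ ->.
- apply/continuous_within_itvP => //; split.
  + move=> t; rewrite in_itv/= => /andP[at_ tx]; apply: fcont.
    by rewrite at_ (lt_trans tx).
  + by apply: fr; rewrite lexx.
  + by apply: cvg_at_left_filter; apply: fcont; rewrite ax.
Unshelve. all: by end_near. Qed.

(** At an exceptional time the function may jump, but only downwards: the left
limit exists and dominates the value.  This is what an angle measured along a
closed curve does when a reflection cuts off a piece of the curve. *)
Lemma piecewise_nonincreasing (s : seq R) f a b : a <= b ->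
  (forall t, a <= t < b -> f x @[x --> t^'+] --> f t) ->
  (forall t, a < t <= b -> exists2 l, f x @[x --> t^'-] --> l & f t <= l) ->
  (forall t, a < t < b -> t \notin s -> exists2 d, is_derive t 1 f d & d <= 0) ->
  f b <= f a.
Proof.
elim: s a b => [a b ab fr fl fd|c s IH a b ab fr fl fd].
  by apply: nonincreasing_between => // t tab; apply: fd.
have [/andP[ac cb]|cab] := boolP (a < c < b); last first.
  apply: IH => // t tab ts; apply: fd => //; rewrite inE negb_or ts andbT.
  by apply: contraNneq cab => <-.
apply: (@le_trans _ _ (f c)).
  apply: IH => [|t /andP[ct tb]|t /andP[ct tb]|t /andP[ct tb] ts].
  - exact: ltW.
  - by apply: fr; rewrite tb (le_trans _ ct)// ltW.
  - by apply: fl; rewrite tb (lt_trans _ ct).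
  - apply: fd; first by rewrite tb (lt_trans _ ct).
    by rewrite inE negb_or ts andbT gt_eqF.
apply: IH => [|t /andP[ct tb]|t /andP[ct tb]|t /andP[ct tb] ts].
- exact: ltW.
- by apply: fr; rewrite ct (lt_trans tb).
- by apply: fl; rewrite ct (le_trans tb)// ltW.
- apply: fd; first by rewrite ct (lt_trans tb).
  by rewrite inE negb_or ts andbT lt_eqF.
Qed.

Lemma piecewise_constant (s : seq R) f a b : a <= b ->
  (forall t, a <= t < b -> f x @[x --> t^'+] --> f t) ->
  (forall t, a < t <= b -> f x @[x --> t^'-] --> f t) ->
  (forall t, a < t < b -> t \notin s -> is_derive t 1 f 0) ->
  f b = f a.
Proof.
move=> ab fr fl fd; apply/eqP; rewrite eq_le; apply/andP; split.
  apply: (@piecewise_nonincreasing s) => // t tab => [|ts].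
    by exists (f t) => //; exact: fl.
  by exists 0 => //; exact: fd.
rewrite -lerN2; apply: (@piecewise_nonincreasing s (- f)) => // t tab.
- by apply: cvgN; exact: fr.
- by exists (- f t) => //; apply: cvgN; exact: fl.
- by move=> ts; exists (- 0); [apply: is_deriveN; exact: fd|rewrite oppr0].
Qed.

(** With [c = cos phi] and [s = sin phi], the quotient is the cotangent of
[phi / 2], and its arc tangent is [pi / 2 - phi / 2]: it is a smooth angle as
long as the rotating point avoids the direction [c = 1]. *)
Lemma is_derive_half_angle (c s : R -> R) w t :
  is_derive t 1 c (- (w * s t)) -> is_derive t 1 s (w * c t) ->
  c t ^+ 2 + s t ^+ 2 = 1 -> c t < 1 ->
  is_derive t 1 (fun x => atan (s x / (1 - c x))) (- (w / 2)).
Proof.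
move=> dc ds cs c1.
have c1' : 1 - c t != 0 by rewrite subr_eq0 gt_eqF.
have d1 : is_derive t 1 (cst 1 - c) (0 - - (w * s t)) by exact: is_deriveB.
have d2 : is_derive t 1 (fun x => (1 - c x)^-1) (- (1 - c t) ^- 2 *: (w * s t)).
  have [dd1 dd2] := d1.
  split; first exact: derivableV.
  by rewrite deriveV// dd2 sub0r opprK.
have d3 := is_deriveM ds d2.
have d4 := @is_derive1_comp R atan _ t _ _ (is_derive1_atan _) d3.
apply: (is_derive_eq d4); rewrite /GRing.scale /=.
have s2 : s t ^+ 2 = 1 - c t ^+ 2 by rewrite -cs; ring.
have -> : (s * (fun x => (1 - c x)^-1)) t = s t / (1 - c t) by [].
have e : 1 + (s t / (1 - c t)) ^+ 2 = 2 / (1 - c t).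
  rewrite expr_div_n s2; field; exact: c1'.
rewrite e.
transitivity (- (w * (s t ^+ 2 - c t * (1 - c t))) / (1 - c t) / 2); last first.
  by rewrite s2; field; exact: c1'.
by field; exact: c1'.
Qed.
End calculus.

(** * Topology of the phase space *)

Section phase_topology.
Context {R : realType} {a b : R}.
Implicit Types (z : state a b).

Lemma phaseP z1 z2 : phase z1 = phase z2 <-> same_phase z1 z2.
Proof.
split=> [/eqmodP/= /asboolP//|h].
by apply/eqmodP/asboolP.
Qed.

Lemma phase_continuous : continuous (@phase R a b).
Proof. exact: pi_continuous. Qed.

Definition saturated (A : set (state a b)) :=
  forall z1 z2, same_phase z1 z2 -> A z1 -> A z2.

(** Open sets of a quotient are the images of saturated open sets. *)
Lemma nbhs_phase_image (A : set (state a b)) z : open A -> saturated A -> A z ->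
  nbhs (phase z) (@phase R a b @` A).
Proof.
move=> oA sA Az; apply: open_nbhs_nbhs; split; last by exists z.
rewrite /open /= /quotient_open [X in open X](_ : _ = A)//.
apply/seteqP; split => [z1 [z2 Az2 /phaseP h]|z1 Az1]; first exact: sA Az2.
by exists z1.
Qed.

Lemma open_stateP (A : set (state a b)) : open A ->
  exists2 W : set ((R * R) * (R * R)), open W & A = set_val @^-1` W.
Proof. by move=> [W oW <-]; exists W. Qed.

Lemma set_val_continuous : continuous (set_val : state a b -> (R * R) * (R * R)).
Proof. exact: initial_continuous. Qed.

Lemma state_inside z : (pos z).1 ^+ 2 / a + (pos z).2 ^+ 2 / b <= 1.
Proof. exact: (set_valP z). Qed.

Lemma compact_set_val (A : set ((R * R) * (R * R))) :
  compact A -> A `<=` inside a b -> compact (set_val @^-1` A : set (state a b)).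
Proof.
move=> cA Ain F FF FA.
have [w [Aw clw]] := cA (set_val @ F) _ FA.
pose z : state a b := exist _ w (mem_set (Ain _ Aw)).
exists z; split=> // B U FB.
rewrite nbhsE => -[U' [/open_stateP[W oW U'W] U'z] U'U].
have [||_ [[z' Bz' <-] Wz']] := clw (set_val @` B) W.
- by rewrite /= nbhs_simpl; apply: filterS FB => z' Bz' /=; exists z'.
- by apply: open_nbhs_nbhs; split => //; move: U'z; rewrite U'W.
- by exists z'; split => //; apply: U'U; rewrite U'W.
Qed.

Lemma continuous_dot : continuous (fun w : (R * R) * (R * R) => dot w.2 w.2).
Proof.
move=> w; rewrite /dot.
by apply: cvgD; apply: cvgM; apply: continuous_comp; (exact: cvg_fst || exact: cvg_snd).
Qed.

Lemma sqr_bound (x M : R) : x ^+ 2 <= M -> - (1 + M) <= x <= 1 + M.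
Proof. by move=> xM; apply/andP; split; nra. Qed.

(** Positions are confined to the table, so a bound on the speed is enough. *)
Lemma compact_bounded_speed (M : R) : 0 < a -> 0 < b ->
  compact [set z : state a b | dot (vel z) (vel z) <= M].
Proof.
move=> a0 b0.
pose A := inside a b `&` [set w | dot w.2 w.2 <= M].
have -> : [set z : state a b | dot (vel z) (vel z) <= M] = set_val @^-1` A.
  apply/seteqP; split => z /=; last by case.
  by split => //; exact: set_valP.
apply: compact_set_val; last by move=> w [].
pose K (r : R) := `[- (1 + r), 1 + r]%classic : set R.
apply: (@subclosed_compact _ A ((K a `*` K b) `*` (K M `*` K M))).
- apply: closedI.
    apply: (@preimage_closed _ _ (fun w : (R * R) * (R * R) =>
      w.1.1 ^+ 2 / a + w.1.2 ^+ 2 / b) [set x | x <= 1]) => [w _|];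
      last exact: closed_le.
    apply: cvgD; apply: cvgM; try exact: cvg_cst.
      apply: (@continuous_comp _ _ _ (fun w : (R * R) * (R * R) => w.1.1)
        (fun x => x ^+ 2)); last exact: exprn_continuous.
      by apply: continuous_comp; exact: cvg_fst.
    apply: (@continuous_comp _ _ _ (fun w : (R * R) * (R * R) => w.1.2)
        (fun x => x ^+ 2)); last exact: exprn_continuous.
    by apply: continuous_comp; [exact: cvg_fst|exact: cvg_snd].
  apply: (@preimage_closed _ _ (fun w : (R * R) * (R * R) => dot w.2 w.2)
    [set x | x <= M]) => [w _|]; last exact: closed_le.
  exact: continuous_dot.
- by repeat apply: compact_setX; exact: segment_compact.
- move=> [[x1 x2] [v1 v2]] [/= xin vM].
  have x1a : 0 <= x1 ^+ 2 / a by rewrite divr_ge0 ?sqr_ge0 ?ltW.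
  have x2b : 0 <= x2 ^+ 2 / b by rewrite divr_ge0 ?sqr_ge0 ?ltW.
  move: vM; rewrite /dot /= => vM.
  split; split; rewrite /K/= in_itv/=; apply: sqr_bound.
  + by rewrite -[leRHS]mul1r -ler_pdivrMr// (le_trans _ xin)// lerDl.
  + by rewrite -[leRHS]mul1r -ler_pdivrMr// (le_trans _ xin)// lerDr.
  + by nra.
  + by nra.
Qed.

End phase_topology.

(** * Orbital stability from conserved quantities *)

Section criterion.
Context {R : realType} {a b : R} (sigma : R).
Implicit Types (z : state a b).

Definition invariant (f : state a b -> R) :=
  forall z1 z2, same_phase z1 z2 -> f z1 = f z2.

(** [H] is the Lyapunov function and [J] selects one of the components of its
zero set.  By compactness [H] has a positive lower bound [d] on the states
of [M_B] that have [J >= 0] but either lie outside the given neighbourhood or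
have [J = 0].  A motion that starts with [H < d] and [0 < J] keeps [H < d], and
[J] cannot change sign without vanishing at some time, which [d] forbids. *)
Lemma orbital_stability_criterion (g : set (phase_space a b))
    (H J : state a b -> R) (M : R) : 0 < a -> 0 < b ->
  continuous (fun z : state a b => p_integral sigma z 0) ->
  invariant (fun z => p_integral sigma z 0) ->
  (forall (z : R -> state a b) (t : R), motion sigma z -> 0 <= t ->
     p_integral sigma (z t) 0 = p_integral sigma (z 0) 0) ->
  continuous H -> invariant H ->
  (forall (z : R -> state a b) (t : R), motion sigma z -> 0 <= t -> H (z t) = H (z 0)) ->
  continuous J -> invariant J ->
  (forall z : R -> state a b, motion sigma z -> {within `[0, +oo[, continuous (J \o z)}) ->
  (forall z, p_integral sigma z 0 <= 0 -> H z <= 1 ->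
     dot (vel z) (vel z) <= M) ->
  (forall z, g (phase z) -> H z <= 0 /\ 0 < J z) ->
  (forall z, p_integral sigma z 0 <= 0 -> 0 <= J z -> H z <= 0 ->
     g (phase z)) ->
  orbitally_stable sigma g.
Proof.
move=> a0 b0 cp ip mp cH iH mH cJ iJ mJ HM gHJ HJg U [UM gU].
pose O := (@phase R a b) @^-1` (interior [set y | M_B sigma y -> U y])
  `&` J @^-1` [set x | 0 < x].
have oO : open O.
  apply: openI; (apply: open_comp; first move=> z _).
  - exact: phase_continuous.
  - exact: open_interior.
  - exact: cJ.
  - exact: open_gt.
have gO z : g (phase z) -> O z by move=> gz; split; [exact: gU|have [] := gHJ _ gz].
have OU z : O z -> p_integral sigma z 0 <= 0 -> U (phase z).
  by move=> [/interior_subset UO _] pz; apply: UO; exists z.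
pose C : set (state a b) :=
  [set z | [/\ p_integral sigma z 0 <= 0, 0 <= J z, H z <= 1 & ~ O z]].
have cC : compact C.
  apply: (@subclosed_compact _ C _ _ (compact_bounded_speed (M := M) a0 b0)).
    rewrite (_ : C = ((fun z => p_integral sigma z 0) @^-1` [set x | x <= 0]
       `&` J @^-1` [set x | 0 <= x]) `&` (H @^-1` [set x | x <= 1] `&` ~` O)); last first.
      by apply/seteqP; split => z [] => [? ? ? ?|[? ?] [? ?]].
    apply: closedI; apply: closedI.
    - by apply: preimage_closed => [z _|]; [exact: cp|exact: closed_le].
    - by apply: preimage_closed => [z _|]; [exact: cJ|exact: closed_ge].
    - by apply: preimage_closed => [z _|]; [exact: cH|exact: closed_le].
    - exact: open_closedC.
  by move=> z [pz _ Hz _]; exact: HM.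
have [d [d0 dO]] : exists d, 0 < d /\ forall z,
    p_integral sigma z 0 <= 0 -> 0 <= J z -> H z < d -> O z.
  have [C0|C0] := pselect (C !=set0); last first.
    exists 1; split => // z pz Jz Hz; apply: contrapT => nO; apply: C0.
    by exists z; split => //; exact: ltW.
  have [|c /set_mem[pc Jc Hc nOc] cmin] := compact_EVT_min C0 cC (f := H).
    exact: continuous_subspaceT.
  have Hc0 : 0 < H c.
    by rewrite ltNge; apply/negP => Hc0; apply: nOc; apply: gO; exact: HJg.
  exists (Order.min 1 (H c)); split; first by rewrite lt_min ltr01.
  move=> z pz Jz; rewrite lt_min => /andP[Hz1 Hzc].
  apply: contrapT => nO; move: Hzc; rewrite ltNge => /negP; apply.
  by apply: cmin; apply/mem_set; split => //; exact: ltW.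
pose A : set (state a b) := [set z | H z < d /\ 0 < J z].
have oA : open A.
  rewrite (_ : A = H @^-1` [set x | x < d] `&` J @^-1` [set x | 0 < x])//.
  apply: openI; (apply: open_comp; first move=> z _).
  - exact: cH.
  - exact: open_lt.
  - exact: cJ.
  - exact: open_gt.
have sA : saturated A by move=> z1 z2 z12; rewrite /A/= (iH _ _ z12) (iJ _ _ z12).
exists (@M_B R sigma a b `&` (@phase R a b) @` A).
  split; first by move=> y [].
  move=> y; have [z ->] : exists z : state a b, y = phase z.
    by exists (repr y); rewrite /phase reprK.
  move=> /gHJ[Hz Jz].
  have := nbhs_phase_image oA sA (conj (le_lt_trans Hz d0) Jz).
  by apply: filterS => y' Ay' My'.
move=> z mz [[z1 pz1 /phaseP z1z] [z2 Az2 /phaseP z2z]] t t0.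
have [Hz0 Jz0] : A (z 0) by exact: sA Az2.
have pz s : 0 <= s -> p_integral sigma (z s) 0 <= 0.
  by move=> s0; rewrite mp// -(ip _ _ z1z).
apply: (OU _ _ (pz _ t0)).
suff Jt s : 0 <= s -> 0 < J (z s) by apply: dO; [exact: pz|apply/ltW/Jt|rewrite mH].
move=> s0; rewrite ltNge; apply/negP => Js.
have [||c] := @IVT R (J \o z) 0 s 0 s0.
- apply: continuous_subspaceW (mJ _ mz) => x /=; rewrite !in_itv/=.
  by case/andP => ->.
- by rewrite /= ge_min le_max (ltW Jz0) Js orbT.
rewrite in_itv/= => /andP[c0 cs] Jc.
have Oc : O (z c) by apply: dO; [exact: pz|rewrite -Jc|rewrite mH].
by case: Oc => _; rewrite /= -Jc /= ltxx.
Qed.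
End criterion.

(** * Componentwise limits and derivatives *)

Section pointwise.
Context {R : realType}.
Implicit Types (f g : R -> R) (t : R) (x v : R -> R * R).

Lemma is_deriveDp f g t df dg : is_derive t 1 f df -> is_derive t 1 g dg ->
  is_derive t 1 (fun s => f s + g s) (df + dg).
Proof. exact: is_deriveD. Qed.

Lemma is_deriveBp f g t df dg : is_derive t 1 f df -> is_derive t 1 g dg ->
  is_derive t 1 (fun s => f s - g s) (df - dg).
Proof. exact: is_deriveB. Qed.

Lemma is_deriveMp f g t df dg : is_derive t 1 f df -> is_derive t 1 g dg ->
  is_derive t 1 (fun s => f s * g s) (f t * dg + g t * df).
Proof. exact: is_deriveM. Qed.

Lemma is_deriveX2 f t df : is_derive t 1 f df ->
  is_derive t 1 (fun s => f s ^+ 2) (2 * f t * df).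
Proof.
move=> dff; have -> : (fun s => f s ^+ 2) = (fun s => f s * f s).
  by apply/funext => s; rewrite expr2.
by apply: (is_derive_eq (is_deriveMp dff dff)); ring.
Qed.

Lemma is_derive_const (c t : R) : is_derive t 1 (fun=> c : R) 0.
Proof. exact: is_derive_cst. Qed.

Lemma is_derive_cvgP (W : normedModType R) (f : R -> W) t d :
  is_derive t 1 f d <->
  (fun h : R => h^-1 *: (f (h *: 1 + t) - f t)) @ 0^' --> d.
Proof.
split=> [[df <-]//|fd]; split; first by apply/cvg_ex; exists d.
exact: cvg_lim.
Qed.

Lemma cvg_fst_of (V W : topologicalType) T (F : set_system T) (f : T -> V * W) (l : V * W) :
  Filter F -> f @ F --> l -> (fun s => (f s).1) @ F --> l.1.
Proof.
by move=> FF fl; apply: (@continuous_cvg _ _ _ F FF f fst l) => //; exact: cvg_fst.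
Qed.

Lemma cvg_snd_of (V W : topologicalType) T (F : set_system T) (f : T -> V * W) (l : V * W) :
  Filter F -> f @ F --> l -> (fun s => (f s).2) @ F --> l.2.
Proof.
by move=> FF fl; apply: (@continuous_cvg _ _ _ F FF f snd l) => //; exact: cvg_snd.
Qed.

Lemma is_derive_pairP x t d : is_derive t 1 x d <->
  is_derive t 1 (fun s => (x s).1) d.1 /\ is_derive t 1 (fun s => (x s).2) d.2.
Proof.
split=> [/is_derive_cvgP xd|[/is_derive_cvgP x1 /is_derive_cvgP x2]].
  by split; apply/is_derive_cvgP; [move/cvg_fst_of: xd|move/cvg_snd_of: xd].
apply/is_derive_cvgP; rewrite [d]surjective_pairing.
exact: cvg_pair x1 x2.
Qed.

End pointwise.

Ltac derive_poly := repeat first [eassumption | apply: is_derive_const |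
  apply: is_deriveX2 | apply: is_deriveDp | apply: is_deriveBp | apply: is_deriveMp].

(** The rule is chosen by the head operation of the expression, so that no rule
is tried up to unfolding. *)
Ltac cvg_poly := rewrite ?/continuous_at; repeat
  lazymatch goal with
  | |- context [fmap (fun s => @Algebra.add _ _ (@Algebra.opp _ _)) _] => apply: cvgB
  | |- context [fmap (fun s => @Algebra.add _ _ _) _] => apply: cvgD
  | |- context [fmap (fun s => @GRing.mul _ _ _) _] => apply: cvgM
  | |- _ => first [eassumption | exact: cvg_cst ]
  end.

(** * Energy, the polynomial p and the tangential velocity *)

Section invariants.
Context {R : realType}.
Implicit Types (a b sigma lam : R) (x v w : R * R) (y : (R * R) * (R * R)).

(** [energy] and [p_integral] as polynomials on the whole of R^4, where they can
be differentiated along a motion and evaluated at incoming velocities, which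
are not velocities of the motion. *)
Definition energy_fun sigma y : R :=
  dot y.2 y.2 / 2 + sigma * dot y.1 y.1 / 2.
Definition p_fun sigma a b lam y : R :=
  (y.2.2 * y.1.1 - y.2.1 * y.1.2) ^+ 2 - (b - lam) * y.2.1 ^+ 2 - (a - lam) * y.2.2 ^+ 2
  - sigma * ((b - lam) * y.1.1 ^+ 2 + (a - lam) * y.1.2 ^+ 2)
  + sigma * (a - lam) * (b - lam).
(** The scalar product of the velocity with [(- x2 / b, x1 / a)], which at points
of the ellipse is the counterclockwise tangent vector. *)
Definition tangential a b y : R := y.1.1 * y.2.2 / a - y.1.2 * y.2.1 / b.

Lemma energyE sigma a b (z : state a b) : energy sigma z = energy_fun sigma (set_val z).
Proof. by []. Qed.

Lemma p_integralE sigma a b (z : state a b) lam :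
  p_integral sigma z lam = p_fun sigma a b lam (set_val z).
Proof.
by rewrite /p_integral /p_fun /pos /vel; case: (set_val z) => [[? ?] [? ?]].
Qed.

Definition reflection_invariant a b (f : (R * R) * (R * R) -> R) :=
  forall x v w, on_ellipse a b x -> reflected a b x v w -> f (x, v) = f (x, w).

Lemma invariant_set_val a b f : reflection_invariant a b f ->
  invariant (fun z : state a b => f (set_val z)).
Proof.
move=> fi z1 z2 [->//|[p12 e1 r12]].
have := fi _ _ _ e1 r12; rewrite {2}p12 /pos /vel.
by case: (set_val z1) (set_val z2) => [? ?] [? ?].
Qed.

Lemma coord_continuous y : [/\ (fun y : (R * R) * (R * R) => y.1.1) @ y --> y.1.1,
  (fun y : (R * R) * (R * R) => y.1.2) @ y --> y.1.2,
  (fun y : (R * R) * (R * R) => y.2.1) @ y --> y.2.1 &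
  (fun y : (R * R) * (R * R) => y.2.2) @ y --> y.2.2].
Proof.
have c1 : fst @ y --> y.1 by exact: cvg_fst.
have c2 : snd @ y --> y.2 by exact: cvg_snd.
split.
- exact: cvg_fst_of c1.
- exact: cvg_snd_of c1.
- exact: cvg_fst_of c2.
- exact: cvg_snd_of c2.
Qed.

Lemma energy_fun_continuous sigma : continuous (energy_fun sigma).
Proof.
move=> y; have [c1 c2 c3 c4] := coord_continuous y.
rewrite /energy_fun /dot; cvg_poly.
Qed.

Lemma tangential_continuous a b : continuous (tangential a b).
Proof.
move=> y; have [c1 c2 c3 c4] := coord_continuous y.
rewrite /tangential; cvg_poly.
Qed.

Lemma p_fun_continuous sigma a b lam : continuous (p_fun sigma a b lam).
Proof.
have -> : p_fun sigma a b lam = fun y : (R * R) * (R * R) =>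
  (y.2.2 * y.1.1 - y.2.1 * y.1.2) * (y.2.2 * y.1.1 - y.2.1 * y.1.2)
  - (b - lam) * (y.2.1 * y.2.1) - (a - lam) * (y.2.2 * y.2.2)
  - sigma * ((b - lam) * (y.1.1 * y.1.1) + (a - lam) * (y.1.2 * y.1.2))
  + sigma * (a - lam) * (b - lam).
  by apply/funext => y'; rewrite /p_fun !expr2.
move=> y; have [c1 c2 c3 c4] := coord_continuous y.
cvg_poly.
Qed.

(** All the values of [p] are functions of [p(0)] and of the energy. *)
Lemma p_fun_affine sigma a b lam y : p_fun sigma a b lam y =
  p_fun sigma a b 0 y + lam * (2 * energy_fun sigma y - sigma * (a + b))
  + sigma * lam ^+ 2.
Proof. by rewrite /p_fun /energy_fun /dot; field. Qed.

(** The scalar product of the velocity with [(x1 / a, x2 / b)], which is normal to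
the ellipse at its points. *)
Definition normal_part a b y : R := y.1.1 * y.2.1 / a + y.1.2 * y.2.2 / b.

(** Hence reflections, which change the sign of the normal part, keep [p(0)],
and the absolute value of the normal part is the same at all the impacts of a
motion. *)
Lemma p_fun0_ellipse sigma a b x v : a != 0 -> b != 0 -> on_ellipse a b x ->
  p_fun sigma a b 0 (x, v) = - (a * b * normal_part a b (x, v) ^+ 2).
Proof.
move=> a0 b0 xE; transitivity (- (a * b * normal_part a b (x, v) ^+ 2) +
    (a * v.2 ^+ 2 + b * v.1 ^+ 2 - sigma * a * b) *
    (x.1 ^+ 2 / a + x.2 ^+ 2 / b - 1)).
  by rewrite /p_fun /normal_part /=; field; rewrite a0 b0.
by rewrite xE subrr mulr0 addr0.
Qed.

Lemma tangential_reflection a b : reflection_invariant a b (tangential a b).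
Proof.
move=> [x1 x2] [v1 v2] [w1 w2] _ [_ /(_ (- (x2 / b), x1 / a))].
rewrite /tangent /dot /tangential /= => h.
by have := h ltac:(ring) => {}h; lra.
Qed.

Lemma energy_reflection sigma a b : reflection_invariant a b (energy_fun sigma).
Proof.
move=> [x1 x2] [v1 v2] [w1 w2] _ [vw /(_ _ vw)].
by rewrite /dot /energy_fun /dot /=; lra.
Qed.

Lemma p_reflection sigma a b lam : a != 0 -> b != 0 ->
  reflection_invariant a b (p_fun sigma a b lam).
Proof.
move=> a0 b0 x v w xE vw.
rewrite p_fun_affine [RHS]p_fun_affine (energy_reflection sigma xE vw).
congr (_ + _ + _); rewrite !p_fun0_ellipse//.
case: vw => + _; rewrite /tangent /normal_part /= => h.
have -> : x.1 * v.1 / a + x.2 * v.2 / b = - (x.1 * w.1 / a + x.2 * w.2 / b).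
  by lra.
by rewrite sqrrN.
Qed.

Definition normal_sq a b x : R := x.1 ^+ 2 / a ^+ 2 + x.2 ^+ 2 / b ^+ 2.

Lemma normal_sq_gt0 a b x : 0 < a -> 0 < b -> on_ellipse a b x ->
  0 < normal_sq a b x.
Proof.
move=> a0 b0 xE; have h1 := sqr_ge0 (x.1 / a); have h2 := sqr_ge0 (x.2 / b).
rewrite /normal_sq -!expr_div_n lt_def addr_ge0// andbT paddr_eq0// !sqrf_eq0.
rewrite !mulf_eq0 !invr_eq0 (gt_eqF a0) (gt_eqF b0) !orbF.
apply/negP => /andP[/eqP x1 /eqP x2]; move: xE.
by rewrite /on_ellipse x1 x2 expr0n !mul0r addr0 => /esym/eqP; rewrite oner_eq0.
Qed.

End invariants.

(** * Conservation along motions *)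

Section conservation.
Context {R : realType} {a b sigma : R}.
Implicit Types (z : R -> state a b) (t : R).

Let x z t := pos (z t).
Let v z t := vel (z t).

Lemma motion_right z t : motion sigma z -> 0 <= t ->
  set_val (z s) @[s --> t^'+] --> set_val (z t).
Proof.
move=> mz t0; rewrite [set_val (z t)]surjective_pairing.
have -> : (fun s => set_val (z s)) = (fun s => ((set_val (z s)).1, (set_val (z s)).2)).
  by apply/funext => s; case: (set_val (z s)).
suff [xc vc] : x z s @[s --> t^'+] --> x z t /\ v z s @[s --> t^'+] --> v z t.
  exact: (cvg_pair xc vc).
have right_of (f : R -> R * R) : {within `[0, +oo[, continuous f} ->
    f s @[s --> t^'+] --> f t.
  move=> /continuous_within_itvcyP[fi f0]; move: t0; rewrite le_eqVlt.
  move=> /predU1P[<-//|t0]; apply: cvg_at_right_filter; apply: fi.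
  by rewrite in_itv/= t0.
case: mz => [[cx rv _ _ _]|[e [_ [cx cv] _ _]]].
  by split; [exact: right_of|exact: rv].
by split; exact: right_of.
Qed.

(** Either the motion is continuous from the left, or it has an incoming velocity
that is related to the outgoing one by the reflection law. *)
Lemma motion_left z t : motion sigma z -> 0 < t ->
  exists2 w, set_val (z s) @[s --> t^'-] --> (x z t, w) &
    w = v z t \/ (on_ellipse a b (x z t) /\ reflected a b (x z t) w (v z t)).
Proof.
move=> mz t0.
have -> : (fun s => set_val (z s)) = (fun s => ((set_val (z s)).1, (set_val (z s)).2)).
  by apply/funext => s; case: (set_val (z s)).
have left_of (f : R -> R * R) : {within `[0, +oo[, continuous f} ->
    f s @[s --> t^'-] --> f t.
  move=> /continuous_within_itvcyP[fi _]; apply: cvg_at_left_filter; apply: fi.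
  by rewrite in_itv/= t0.
case: mz => [[cx rv dxv hit _]|[e [_ [cx cv] _ _]]]; last first.
  exists (v z t); last by left.
  exact: (cvg_pair (left_of _ cx) (left_of _ cv)).
have [xE|xE] := pselect (on_ellipse a b (x z t)).
  have [w vw refl] := hit t t0 xE.
  exists w; last by right.
  exact: (cvg_pair (left_of _ cx) vw).
exists (v z t); last by left.
suff vw : v z s @[s --> t^'-] --> v z t by exact: (cvg_pair (left_of _ cx) vw).
apply: cvg_at_left_filter; apply: differentiable_continuous.
by apply/derivable1_diffP; have [_ []] := dxv t t0 xE.
Qed.

Section continuity.
Variable f : (R * R) * (R * R) -> R.
Hypothesis cf : continuous f.
Hypothesis fi : reflection_invariant a b f.

Lemma invariant_right z t : motion sigma z -> 0 <= t ->
  f (set_val (z s)) @[s --> t^'+] --> f (set_val (z t)).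
Proof.
by move=> mz t0; apply: continuous_cvg; [exact: cf|exact: motion_right].
Qed.

Lemma invariant_left z t : motion sigma z -> 0 < t ->
  f (set_val (z s)) @[s --> t^'-] --> f (set_val (z t)).
Proof.
move=> mz t0; have [w zw ww] := motion_left mz t0.
have -> : f (set_val (z t)) = f (x z t, w).
  rewrite [set_val (z t)]surjective_pairing.
  by case: ww => [->//|[xE refl]]; rewrite (fi xE refl).
by apply: continuous_cvg; [exact: cf|exact: zw].
Qed.

(** Reflection-invariant functions do not see the jumps of the velocity. *)
Lemma invariant_within_continuous z : motion sigma z ->
  {within `[0, +oo[, continuous (fun t => f (set_val (z t)))}.
Proof.
move=> mz; apply/continuous_within_itvcyP; split.
  move=> t; rewrite in_itv/= andbT => t0; apply/left_right_continuousP; split.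
    exact: invariant_left.
  by apply: invariant_right => //; exact: ltW.
exact: invariant_right.
Qed.

Lemma invariant_conserved z : billiard_motion sigma z ->
  (forall t, is_derive t 1 (x z) (v z t) -> is_derive t 1 (v z) (- sigma *: x z t) ->
    is_derive t 1 (fun s => f (set_val (z s))) 0) ->
  forall t, 0 <= t -> f (set_val (z t)) = f (set_val (z 0)).
Proof.
move=> bz fd T T0; have mz : motion sigma z by left.
have [_ _ dxv _ fin] := bz.
have /finite_seqP[h hE] := fin T.
apply: (@piecewise_constant R h (fun s => f (set_val (z s))) 0 T) => // t /andP[t0 tT].
- exact: invariant_right.
- exact: invariant_left.
- move=> th; have [|dx dv] := dxv t t0; last exact: fd.
  move=> xE; move/negP: th; apply.
  have : [set t | 0 <= t <= T /\ on_ellipse a b (x z t)] t.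
    by split => //; rewrite !ltW.
  by rewrite hE.
Qed.
End continuity.

Lemma flow_derivatives z t :
  is_derive t 1 (x z) (v z t) -> is_derive t 1 (v z) (- sigma *: x z t) ->
  [/\ is_derive t 1 (fun s => (set_val (z s)).1.1) (set_val (z t)).2.1,
      is_derive t 1 (fun s => (set_val (z s)).1.2) (set_val (z t)).2.2,
      is_derive t 1 (fun s => (set_val (z s)).2.1) (- sigma * (set_val (z t)).1.1) &
      is_derive t 1 (fun s => (set_val (z s)).2.2) (- sigma * (set_val (z t)).1.2)].
Proof. by move=> /is_derive_pairP[? ?] /is_derive_pairP[? ?]. Qed.

Lemma energy_conserved z t : motion sigma z -> 0 <= t ->
  energy_fun sigma (set_val (z t)) = energy_fun sigma (set_val (z 0)).
Proof.
move=> [bz|[e [_ _ _ lz]]] t0; last first.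
  have eE s : 0 <= s -> energy_fun sigma (set_val (z s)) = e.
    by move=> /lz[_ _]; rewrite /energy_fun -/(vel (z s)) -/(pos (z s)) => ->; field.
  by rewrite !eE.
apply: (invariant_conserved (f := energy_fun sigma)) => //.
- exact: energy_fun_continuous.
- exact: energy_reflection.
move=> s dx dv; have [d1 d2 d3 d4] := flow_derivatives dx dv.
by rewrite /energy_fun /dot; eapply is_derive_eq; [derive_poly|rewrite /GRing.scale /=; field].
Qed.

Lemma p_conserved lam z t : a != 0 -> b != 0 -> motion sigma z -> 0 <= t ->
  p_fun sigma a b lam (set_val (z t)) = p_fun sigma a b lam (set_val (z 0)).
Proof.
move=> a0 b0 mz t0; rewrite p_fun_affine [RHS]p_fun_affine energy_conserved//.
congr (_ + _ + _).
case: mz => [bz|[e [_ _ _ lz]]]; last first.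
  have eE s : 0 <= s -> p_fun sigma a b 0 (set_val (z s)) = 0.
    move=> /lz[zE zt _]; rewrite [set_val _]surjective_pairing p_fun0_ellipse//.
    by move: zt; rewrite /normal_part /= /tangent => ->; rewrite expr0n mulr0 oppr0.
  by rewrite !eE.
apply: (invariant_conserved (f := p_fun sigma a b 0)) => //.
- exact: p_fun_continuous.
- exact: p_reflection.
move=> s dx dv; have [d1 d2 d3 d4] := flow_derivatives dx dv.
by rewrite /p_fun; eapply is_derive_eq; [derive_poly|rewrite /GRing.scale /=; field].
Qed.

End conservation.

(** * Sweeping a closed curve *)

Section sweep.
Context {R : realType}.
Implicit Types (f y w : R -> R) (c s t T : R).

Lemma atan_nondecreasing : {homo (@atan R) : x y / x <= y}.
Proof.
move=> x y xy.
have d t : is_derive t 1 (@atan R) (1 + t ^+ 2)^-1 by exact: is_derive1_atan.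
apply: (@ger0_derive1_le_cc R atan x y); rewrite ?in_itv/= ?lexx ?xy//.
- move=> t _; rewrite derive1E; have [_ ->] := d t.
  by rewrite invr_ge0 addr_ge0 ?sqr_ge0 ?ler01.
- by apply: continuous_subspaceT => t; exact: continuous_atan.
Qed.

Lemma near_left_notin (h : seq R) t : \forall s \near t^'-, s \notin h.
Proof.
elim: h => [|c h IH]; first by apply: nearW.
have [ct|tc] := ltP c t; near=> s; rewrite inE negb_or; apply/andP;
  split; try by near: s.
  have cs : c < s by near: s; exact: nbhs_left_gt.
  by rewrite gt_eqF.
have st : s < t by near: s; exact: nbhs_left_lt.
by rewrite lt_eqF// (lt_le_trans st).
Unshelve. all: by end_near. Qed.

Lemma at_left_interval (P : R -> Prop) t : 0 < t -> (\forall s \near t^'-, P s) ->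
  exists2 t1, 0 < t1 < t & forall s, t1 <= s < t -> P s.
Proof.
move=> t0; rewrite near_withinE => /nbhs_ballP[/= d d0 dP].
exists (Num.max (t / 2) (t - d / 2)).
  apply/andP; split; first by rewrite lt_max; apply/orP; left; lra.
  by rewrite gt_max; apply/andP; split; lra.
move=> s /andP[]; rewrite ge_max => /andP[s1 s2] st; apply: dP => //.
by rewrite /ball/= gtr0_norm; lra.
Qed.

(** The arc tangent takes values in an interval of length [pi], so it cannot
decrease at a positive rate for all times. *)
Lemma atan_decay_absurd (q : R -> R) (k : R) : 0 < k ->
  (forall t, 0 <= t -> q s @[s --> t^'+] --> q t) ->
  (forall t, 0 < t -> exists2 l, q s @[s --> t^'-] --> l & q t <= l) ->
  (forall T, 0 <= T -> exists h : seq R, forall t, 0 < t < T -> t \notin h ->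
    exists2 d, is_derive t 1 (fun s => atan (q s)) d & d <= - k) ->
  False.
Proof.
move=> k0 qr ql qd.
(* long enough for a decrease larger than the range of the arc tangent *)
pose T := (pi + 1) / k.
have T0 : 0 <= T by rewrite divr_ge0 ?ltW// addr_gt0// pi_gt0.
have [h hd] := qd T T0.
have : atan (q T) + k * T <= atan (q 0) + k * 0.
  have kc t : is_derive t 1 (fun s => k * s) k.
    apply: (is_derive_eq (is_deriveMp (is_derive_const k t) (is_derive_id t 1))).
    by rewrite /= mulr0 addr0 mulr1.
  have kcont t : {for t, continuous (fun s => k * s)}.
    by apply: cvgM; [exact: cvg_cst|exact: cvg_id].
  apply: (@piecewise_nonincreasing R h (fun s => atan (q s) + k * s) 0 T) => //.
  - move=> t /andP[t0 tT]; apply: cvgD.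
      by apply: continuous_cvg; [exact: continuous_atan|exact: qr].
    by apply: cvg_at_right_filter; exact: kcont.
  - move=> t /andP[t0 tT]; have [l ql' lq] := ql t t0.
    exists (atan l + k * t); last by rewrite lerD2r; exact: atan_nondecreasing.
    apply: cvgD.
      by apply: continuous_cvg; [exact: continuous_atan|exact: ql'].
    by apply: cvg_at_left_filter; exact: kcont.
  - move=> t tT th; have [d dq dk] := hd t tT th.
    exists (d + k); first by apply: is_deriveDp => //; exact: kc.
    by lra.
have -> : k * T = pi + 1 by rewrite /T mulrC mulfVK ?gt_eqF.
rewrite mulr0 addr0.
have := atan_ltpi2 (q 0); have := atan_gtNpi2 (q T).
by lra.
Qed.

(** A coordinate that attains its maximum at [t] and was below it just before
arrives with nonnegative velocity. *)
Lemma incoming_sign y w (b wm t : R) (h : seq R) : 0 < t ->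
  (forall s, 0 <= s -> y s <= b) -> y t = b ->
  (forall s, 0 <= s -> y u @[u --> s^'+] --> y s) ->
  (forall s, 0 < s -> y u @[u --> s^'-] --> y s) ->
  (forall s, 0 < s < t -> s \notin h -> y s < b /\ is_derive s 1 y (w s)) ->
  w u @[u --> t^'-] --> wm -> 0 <= wm.
Proof.
move=> t0 yb ytb yr yl yd wl; rewrite leNgt; apply/negP => wm0.
have Pn : \forall s \near t^'-, w s < 0 /\ s \notin h.
  near=> s; split; near: s; last exact: near_left_notin.
  by apply: (cvgr_lt wm).
have [t1 /andP[t10 t1t] Pt1] := at_left_interval t0 Pn.
suff : y t <= y t1.
  have [_ t1h] := Pt1 t1 ltac:(by rewrite lexx).
  have [] := yd t1 ltac:(by rewrite t10) t1h.
  by rewrite ytb => yt1 _ yy; lra.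
apply: (@nonincreasing_between R y t1 t); first exact: ltW.
- by move=> s /andP[s1 _]; apply: yr; lra.
- by move=> s /andP[s1 _]; exists (y s) => //; apply: yl; lra.
- move=> s /andP[s1 s2]; have [ws sh] := Pt1 s ltac:(by rewrite s2 ltW).
  have [|_ ds] := yd s _ sh; first by rewrite s2 (lt_trans t10).
  by exists (w s) => //; exact: ltW.
Unshelve. all: by end_near. Qed.


(** On the ellipse [w^2 + o2 y^2 = r2], a reflection at height [Y] replaces
[W] by [- W].  At an impact [W] has the sign of [Y] and no height exceeds
[|Y|], so the point jumps forward over an arc that is never visited, and its
stereographic coordinate from [(y0, w0)] decreases.  After clearing the
denominators the two sides differ by [2 r2 W (Y - y0)]. *)
Lemma rotation_jump (Y W y0 w0 r2 o2 : R) : 0 < r2 -> 0 <= W * (Y - y0) ->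
  W ^+ 2 + o2 * Y ^+ 2 = r2 -> w0 ^+ 2 + o2 * y0 ^+ 2 = r2 ->
  0 < r2 - o2 * Y * y0 - W * w0 -> 0 < r2 - o2 * Y * y0 + W * w0 ->
  (Y * w0 + W * y0) / (r2 - o2 * Y * y0 + W * w0) <=
  (Y * w0 - W * y0) / (r2 - o2 * Y * y0 - W * w0).
Proof.
move=> r0 WY YW yw d1 d2; rewrite ler_pdivrMr// mulrAC ler_pdivlMr//.
rewrite -subr_ge0; suff -> : (Y * w0 - W * y0) * (r2 - o2 * Y * y0 + W * w0) -
    (Y * w0 + W * y0) * (r2 - o2 * Y * y0 - W * w0) = 2 * r2 * (W * (Y - y0)).
  by rewrite mulr_ge0// mulr_ge0// ltW.
transitivity (2 * W * (Y * (w0 ^+ 2 + o2 * y0 ^+ 2) - y0 * r2)); first by ring.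
by rewrite yw; ring.
Qed.

(** If [(y0, w0)] were missed, the point [(o y, w)] would rotate at constant
speed [o], and skip arcs at the impacts, without ever meeting the direction of
[(o y0, w0)].  Its half-angle from this direction would contradict
[atan_decay_absurd].  When [y0] is an end point, [(y0, w0)] and [(y0, - w0)]
are the same phase point and both are missed. *)
Lemma oscillator_sweep y w (b o r y0 w0 : R) : 0 < o -> 0 < r ->
  (forall t, 0 <= t -> - b <= y t <= b) ->
  (forall t, 0 <= t -> w t ^+ 2 + o ^+ 2 * y t ^+ 2 = r ^+ 2) ->
  (forall t, 0 <= t -> y u @[u --> t^'+] --> y t) ->
  (forall t, 0 < t -> y u @[u --> t^'-] --> y t) ->
  (forall t, 0 <= t -> w u @[u --> t^'+] --> w t) ->
  (forall t, 0 < t -> y t != b -> y t != - b ->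
    is_derive t 1 y (w t) /\ is_derive t 1 w (- o ^+ 2 * y t)) ->
  (forall t, 0 < t -> (y t == b) || (y t == - b) -> w u @[u --> t^'-] --> - w t) ->
  (forall T, exists h : seq R, forall t, 0 <= t <= T ->
    (y t == b) || (y t == - b) -> t \in h) ->
  - b <= y0 <= b -> w0 ^+ 2 + o ^+ 2 * y0 ^+ 2 = r ^+ 2 ->
  exists2 t, 0 <= t & y t = y0 /\
    (w t = w0 \/ w t = - w0 /\ (y0 == b) || (y0 == - b)).
Proof.
move=> o0 r0 yb E yr yl wr ywd wh fin y0b E0.
apply: contrapT => nvisit.
have r20 : 0 < r ^+ 2 by rewrite exprn_gt0.
have rn : r != 0 by rewrite gt_eqF.
have miss Y W : W ^+ 2 + o ^+ 2 * Y ^+ 2 = r ^+ 2 -> Y != y0 \/ W != w0 ->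
    0 < r ^+ 2 - o ^+ 2 * Y * y0 - W * w0.
  move=> EW YW.
  have -> : r ^+ 2 - o ^+ 2 * Y * y0 - W * w0 =
      (o ^+ 2 * (Y - y0) ^+ 2 + (W - w0) ^+ 2) / 2.
    have -> : r ^+ 2 = (w0 ^+ 2 + o ^+ 2 * y0 ^+ 2) / 2 + (W ^+ 2 + o ^+ 2 * Y ^+ 2) / 2.
      by rewrite E0 EW; field.
    by field.
  have p1 : 0 <= o ^+ 2 * (Y - y0) ^+ 2 by apply: mulr_ge0; exact: sqr_ge0.
  have p2 : 0 <= (W - w0) ^+ 2 by exact: sqr_ge0.
  apply: divr_gt0 => //; rewrite lt_def addr_ge0// andbT paddr_eq0//.
  rewrite mulf_eq0 !sqrf_eq0 !subr_eq0 (gt_eqF o0)/=.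
  by case: YW => /negbTE ->; rewrite ?andbF.
pose N t := r ^+ 2 - o ^+ 2 * y t * y0 - w t * w0.
have N0 t : 0 <= t -> 0 < N t.
  move=> t0; apply: miss; first exact: E.
  have [yt|] := eqVneq (y t) y0; last by left.
  right; apply/eqP => wt; apply: nvisit; exists t => //.
  by split => //; left.
pose q t := o * (y t * w0 - w t * y0) / N t.
have qcont (F : set_system R) (FF : Filter F) (Y W : R) : y @ F --> Y -> w @ F --> W ->
    0 < r ^+ 2 - o ^+ 2 * Y * y0 - W * w0 ->
    q @ F --> o * (Y * w0 - W * y0) / (r ^+ 2 - o ^+ 2 * Y * y0 - W * w0).
  move=> yY wW NN; apply: cvgM; first by cvg_poly.
  apply: cvgV; first by rewrite gt_eqF.
  by rewrite /N; cvg_poly.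
have o20 : 0 < o / 2 by rewrite divr_gt0.
apply: (@atan_decay_absurd q (o / 2)) => //.
- by move=> t t0; apply: qcont; [exact: yr|exact: wr|exact: N0].
- move=> t t0; have [hit|nhit] := boolP ((y t == b) || (y t == - b)); last first.
    exists (q t) => //; move: nhit; rewrite negb_or => /andP[n1 n2].
    have [_ [dw _]] := ywd t t0 n1 n2.
    apply: qcont; [exact: yl| |exact: N0 (ltW t0)].
    apply: cvg_at_left_filter; apply: differentiable_continuous.
    exact/derivable1_diffP.
  have Nm : 0 < r ^+ 2 - o ^+ 2 * y t * y0 - (- w t) * w0.
    apply: miss; first by rewrite sqrrN; apply: E; exact: ltW.
    have [yt|] := eqVneq (y t) y0; last by left.
    right; apply/eqP => wt; apply: nvisit; exists t; first exact: ltW.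
    by split => //; right; rewrite -wt opprK -yt.
  exists (o * (y t * w0 - (- w t) * y0) / (r ^+ 2 - o ^+ 2 * y t * y0 - (- w t) * w0)).
    by apply: qcont; [exact: yl|exact: wh|exact: Nm].
  rewrite /q /N -[leLHS]mulrA -[leRHS]mulrA ler_pM2l//.
  move: (N0 t (ltW t0)) Nm; rewrite /N !mulNr !opprK => Np Nm.
  have [h hh] := fin t.
  have nh s : 0 < s < t -> s \notin h -> ~~ ((y s == b) || (y s == - b)).
    move=> /andP[s0 st]; apply: contra; apply: hh; by rewrite !ltW.
  have WY : 0 <= - w t * (y t - y0).
    case/orP: hit => /eqP yt.
      apply: mulr_ge0; last by rewrite yt subr_ge0; case/andP: y0b.
      apply: (@incoming_sign y w b (- w t) t h) => //.
      - by move=> s s0; have /andP[] := yb s s0.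
      - move=> s /[dup] /andP[s0 _] st /(nh s st); rewrite negb_or => /andP[n1 n2].
        have [dy _] := ywd s s0 n1 n2; split => //.
        by rewrite lt_neqAle n1; have /andP[] := yb s (ltW s0).
      - by apply: wh => //; rewrite yt eqxx.
    rewrite mulNr -mulrN opprB; apply: mulr_ge0; last first.
      by rewrite yt subr_ge0; case/andP: y0b.
    apply: (@incoming_sign (- y) (- w) b (w t) t h) => //.
    - by move=> s s0; rewrite opprfctE lerNl; have /andP[] := yb s s0.
    - by rewrite opprfctE yt opprK.
    - by move=> s s0; apply: cvgN; exact: yr.
    - by move=> s s0; apply: cvgN; exact: yl.
    - move=> s /[dup] /andP[s0 _] st /(nh s st); rewrite negb_or => /andP[n1 n2].
      have [dy _] := ywd s s0 n1 n2; split; last exact: is_deriveN.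
      rewrite opprfctE ltrNl lt_neqAle eq_sym n2.
      by have /andP[] := yb s (ltW s0).
    - by rewrite -[w t]opprK; apply: cvgN; apply: wh => //; rewrite yt eqxx orbT.
  have := @rotation_jump (y t) (- w t) y0 w0 (r ^+ 2) (o ^+ 2) r20 WY.
  rewrite sqrrN !mulNr !opprK; apply => //.
  by apply: E; exact: ltW.
- move=> T T0; have [h hh] := fin T.
  exists h => t /andP[t0 tT] th.
  have : ~~ ((y t == b) || (y t == - b)).
    by apply: contra th => hit; apply: hh => //; rewrite !ltW.
  rewrite negb_or => /andP[n1 n2]; have [dy dw] := ywd t t0 n1 n2.
  exists (- (o / 2)); last by [].
  pose c u := (o ^+ 2 * y u * y0 + w u * w0) / r ^+ 2.
  pose s u := o * (y u * w0 - w u * y0) / r ^+ 2.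
  have dc : is_derive t 1 c (- (o * s t)).
    by rewrite /c; eapply is_derive_eq; [derive_poly|rewrite /GRing.scale/= /s; field].
  have ds : is_derive t 1 s (o * c t).
    by rewrite /s; eapply is_derive_eq; [derive_poly|rewrite /GRing.scale/= /c; field].
  have cs1 : c t ^+ 2 + s t ^+ 2 = 1.
    transitivity ((w t ^+ 2 + o ^+ 2 * y t ^+ 2) * (w0 ^+ 2 + o ^+ 2 * y0 ^+ 2) / r ^+ 2 / r ^+ 2).
      by rewrite /c /s; field.
    by rewrite E0 E ?ltW//; field.
  (* [c] and [s] are the cosine and the sine of the angle from [(o y0, w0)] *)
  have Nc u : N u = r ^+ 2 * (1 - c u) by rewrite /N /c; field.
  have c1 : c t < 1.
    have := N0 t (ltW t0); rewrite Nc pmulr_rgt0// subr_gt0.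
    by [].
  have := is_derive_half_angle dc ds cs1 c1.
  suff -> : (fun u => atan (s u / (1 - c u))) = (fun u => atan (q u)) by [].
  apply/funext => u; congr atan; rewrite /q Nc /s.
  have [->|cu] := eqVneq (1 - c u) 0; first by rewrite mulr0 !invr0 !mulr0.
  by field; rewrite cu.
Qed.
End sweep.

(** * Motions on a coordinate axis *)

Section axis.
Context {R : realType}.
Implicit Types (y w : R -> R) (t T : R).

Lemma near_right_notin (h : seq R) t : \forall s \near t^'+, s \notin h.
Proof.
elim: h => [|c h IH]; first by apply: nearW.
have [tc|ct] := ltP t c; near=> s; rewrite inE negb_or; apply/andP;
  split; try by near: s.
  have cs : s < c by near: s; exact: nbhs_right_lt.
  by rewrite lt_eqF.
have st : t < s by near: s; exact: nbhs_right_gt.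
by rewrite gt_eqF// (le_lt_trans ct).
Unshelve. all: by end_near. Qed.

Lemma zero_velocity y w : (forall t, 0 <= t -> y t = 0) ->
  (forall t, 0 <= t -> w u @[u --> t^'+] --> w t) ->
  (forall T, exists h : seq R, forall t, 0 < t < T -> t \notin h ->
     is_derive t 1 y (w t)) ->
  forall t, 0 <= t -> w t = 0.
Proof.
move=> y0 wr yd t t0; have [h hd] := yd (t + 1).
have w0 s : t < s < t + 1 -> s \notin h -> w s = 0.
  move=> /andP[ts st] sh; have s0 : 0 < s by exact: le_lt_trans ts.
  have [|_ <-] := hd s _ sh; first by rewrite s0.
  rewrite -(derive_cst (0 : R) s 1); apply: near_eq_derive.
  near=> u; rewrite y0//; apply: ltW; near: u.
  exact: lt_nbhsr.
apply: (@cvg_unique _ _ (w u @[u --> t^'+])) (wr t t0) _ => //.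
apply: cvg_near_cst; near=> s; apply: w0; last by near: s; exact: near_right_notin.
apply/andP; split; near: s; first exact: nbhs_right_gt.
by apply: nbhs_right_lt; rewrite ltrDl.
Unshelve. all: by end_near. Qed.

(** The axes are treated together: for [i = true] the motion has [x1 = 0] and
moves along [x2]; for [i = false] the roles are exchanged. *)
Definition coord (i : bool) (x : R * R) : R := if i then x.1 else x.2.

Context {a b sigma : R}.
Hypotheses (a0 : 0 < a) (b0 : 0 < b) (s0 : 0 < sigma).

Let l i := if i then b else a.
Let l0 i : 0 < l i. Proof. by case: i. Qed.

Lemma coord_eq i (p q : R * R) : coord i p = coord i q ->
  coord (~~ i) p = coord (~~ i) q -> p = q.
Proof. by case: i p q => -[p1 p2] [q1 q2] /= -> ->. Qed.

Lemma ellipse_axis i x : coord i x = 0 ->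
  x.1 ^+ 2 / a + x.2 ^+ 2 / b = coord (~~ i) x ^+ 2 / l i.
Proof. by case: i => /= ->; rewrite expr0n mul0r ?add0r ?addr0. Qed.

Lemma tangent_axis i x v : coord i x = 0 ->
  (tangent a b x v <-> coord (~~ i) x * coord (~~ i) v / l i = 0).
Proof. by case: i; rewrite /tangent => /= ->; rewrite !mul0r ?add0r ?addr0. Qed.

Lemma dot_axis i x v : dot x v =
  coord i x * coord i v + coord (~~ i) x * coord (~~ i) v.
Proof. by case: i; rewrite /dot //= addrC. Qed.

Lemma on_ellipse_axis i x : coord i x = 0 -> on_ellipse a b x <->
  (coord (~~ i) x == Num.sqrt (l i)) || (coord (~~ i) x == - Num.sqrt (l i)).
Proof.
move=> xi; rewrite /on_ellipse (ellipse_axis xi) -eqf_sqr sqr_sqrtr ?ltW//.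
split=> [e|/eqP ->]; last by rewrite divff// gt_eqF.
by apply/eqP; rewrite -[RHS]mul1r -e mulfVK// gt_eqF.
Qed.

Lemma cvg_coord i (I : Type) (F : set_system I) (FF : Filter F) (f : I -> R * R) p :
  f @ F --> p -> (fun s => coord i (f s)) @ F --> coord i p.
Proof. by case: i => fp; [exact: cvg_fst_of fp|exact: cvg_snd_of fp]. Qed.

Lemma is_derive_coord i (f : R -> R * R) t d : is_derive t 1 f d ->
  is_derive t 1 (fun s => coord i (f s)) (coord i d).
Proof. by move=> /is_derive_pairP[d1 d2]; case: i. Qed.

(** An axial motion is a harmonic oscillator reflected at the two vertices of
its axis, and its orbit is the whole set of axial states of its energy. *)
Lemma axis_visits i e (z : R -> state a b) : billiard_motion sigma z ->
  energy sigma (z 0) = e -> 0 < e ->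
  (forall t, 0 <= t -> coord i (pos (z t)) = 0) ->
  (forall t, 0 <= t -> coord i (vel (z t)) = 0) /\
  forall z0 : state a b, coord i (pos z0) = 0 -> coord i (vel z0) = 0 ->
    energy sigma z0 = e -> phase_orbit z (phase z0).
Proof.
move=> bz ze e0 xi; have mz : motion sigma z by left.
have [cx rv dxv hit fin] := bz.
have v0 t : 0 <= t -> coord i (vel (z t)) = 0.
  apply: (@zero_velocity (fun t => coord i (pos (z t)))
    (fun t => coord i (vel (z t)))) => //.
    by move=> u u0; apply: cvg_coord; exact: rv.
  move=> T; have /finite_seqP[h hE] := fin T; exists h => u /andP[u0 uT] uh.
  apply: is_derive_coord; have [|//] := dxv u u0.
  move=> uE; move/negP: uh; apply.
  suff : [set` h] u by [].
  by rewrite -hE; split => //; rewrite !ltW.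
split=> // z0 xi0 vi0 z0e.
have En (z1 : state a b) : coord i (pos z1) = 0 -> coord i (vel z1) = 0 ->
    energy sigma z1 = e -> coord (~~ i) (vel z1) ^+ 2 +
      Num.sqrt sigma ^+ 2 * coord (~~ i) (pos z1) ^+ 2 = Num.sqrt (2 * e) ^+ 2.
  move=> xi1 vi1 <-; rewrite sqr_sqrtr ?ltW// sqr_sqrtr; last first.
    have h1 := mulr_ge0 (ltW s0) (sqr_ge0 (coord (~~ i) (pos z1))).
    have h2 := sqr_ge0 (coord (~~ i) (vel z1)).
    by rewrite /energy !(dot_axis i) xi1 vi1; lra.
  by rewrite /energy !(dot_axis i) xi1 vi1; field.
have bound (z1 : state a b) : coord i (pos z1) = 0 ->
    - Num.sqrt (l i) <= coord (~~ i) (pos z1) <= Num.sqrt (l i).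
  move=> xi1; have := state_inside z1.
  rewrite (ellipse_axis xi1) ler_pdivrMr// mul1r => h.
  by rewrite -ler_norml -sqrtr_sqr ler_sqrt// ltW.
have [t t0 [yt wt]] : exists2 t, 0 <= t &
    coord (~~ i) (pos (z t)) = coord (~~ i) (pos z0) /\
    (coord (~~ i) (vel (z t)) = coord (~~ i) (vel z0) \/
     coord (~~ i) (vel (z t)) = - coord (~~ i) (vel z0) /\
     (coord (~~ i) (pos z0) == Num.sqrt (l i)) || (coord (~~ i) (pos z0) == - Num.sqrt (l i))).
  apply: (@oscillator_sweep R (fun t => coord (~~ i) (pos (z t)))
     (fun t => coord (~~ i) (vel (z t))) (Num.sqrt (l i)) (Num.sqrt sigma)
     (Num.sqrt (2 * e))).
  - by rewrite sqrtr_gt0.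
  - by rewrite sqrtr_gt0 mulr_gt0.
  - by move=> t t0; apply: bound; exact: xi.
  - move=> t t0; apply: En; [exact: xi|exact: v0|].
    by rewrite energyE energy_conserved// -energyE.
  - move=> t t0; apply: cvg_coord; have := motion_right mz t0.
    exact: cvg_fst_of.
  - move=> t t0; apply: cvg_coord; have [w + _] := motion_left mz t0.
    exact: cvg_fst_of.
  - by move=> t t0; apply: cvg_coord; exact: rv.
  - move=> t t0 n1 n2; have [|dx dv] := dxv t t0.
      by move=> /(on_ellipse_axis (xi t (ltW t0))); rewrite (negbTE n1) (negbTE n2).
    split; first exact: is_derive_coord.
    rewrite sqr_sqrtr ?ltW//.
    by have := is_derive_coord (~~ i) dv; case: (~~ i).
  - move=> t t0 /(on_ellipse_axis (xi t (ltW t0))) tE.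
    have [w vw [+ _]] := hit t t0 tE.
    move=> /(tangent_axis _ (xi t (ltW t0))) wE.
    have y0 : coord (~~ i) (pos (z t)) != 0.
      apply/eqP => y0; move: tE; rewrite /on_ellipse (ellipse_axis (xi t (ltW t0))) y0.
      by rewrite expr0n mul0r => /esym/eqP; rewrite oner_eq0.
    have -> : - coord (~~ i) (vel (z t)) = coord (~~ i) w.
      move/eqP: wE; rewrite mulf_eq0 invr_eq0 (gt_eqF (l0 i)) orbF mulf_eq0 (negbTE y0)/=.
      have -> : coord (~~ i) (w + vel (z t)) = coord (~~ i) w + coord (~~ i) (vel (z t)).
        by case: (~~ i).
      by rewrite addr_eq0 => /eqP ->.
    exact: cvg_coord.
  - move=> T; have /finite_seqP[h hE] := fin T; exists h => t /andP[t0 tT] tE.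
    suff : [set` h] t by [].
    rewrite -hE; split; first by rewrite t0.
    exact/(on_ellipse_axis (xi t t0)).
  - exact: bound.
  - exact: En.
exists t; first by rewrite /= in_itv/= t0.
have xx : pos (z t) = pos z0 by apply: (@coord_eq i) => //; rewrite xi.
apply/phaseP; case: wt => [wt|[wt yE]].
  left; apply: val_inj; rewrite [LHS]surjective_pairing [RHS]surjective_pairing.
  have : vel (z t) = vel z0 by apply: (@coord_eq i) => //; rewrite v0.
  by move: xx; rewrite /pos /vel set_valE => -> ->.
right; split => //; first by apply/(on_ellipse_axis (xi t t0)); rewrite yt.
have wv : vel (z t) = - vel z0.
  apply: (@coord_eq i); first by rewrite v0//; move: vi0; case: (i) => /= ->; rewrite oppr0.
  by rewrite wt; case: (~~ i).
split.
  rewrite wv addNr; apply/(tangent_axis _ (xi t t0)).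
  by case: (~~ i); rewrite mulr0 mul0r.
move=> u /(tangent_axis _ (xi t t0))/eqP.
rewrite mulf_eq0 invr_eq0 (gt_eqF (l0 i)) orbF mulf_eq0 => /orP[|/eqP u0].
  move=> /eqP yt0; move: yE; rewrite -yt yt0 eq_sym sqrtr_eq0 leNgt l0/=.
  by rewrite eq_sym oppr_eq0 sqrtr_eq0 leNgt l0.
rewrite (dot_axis i) u0 mulr0 addr0 wv.
have -> : coord i (- vel z0 - vel z0) = 0.
  by move: vi0; case: (i) => /= ->; rewrite oppr0 addr0.
by rewrite mul0r.
Qed.

End axis.

(** * Stability along the y-axis *)

Section stable.
Context {R : realType} {a b sigma : R}.
Hypotheses (b0 : 0 < b) (ab : b < a) (s0 : 0 < sigma).

Let a0 : 0 < a. Proof. exact: lt_trans ab. Qed.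
Let an0 : a != 0. Proof. by rewrite gt_eqF. Qed.
Let bn0 : b != 0. Proof. by rewrite gt_eqF. Qed.

Lemma comp_set_val_continuous (f : (R * R) * (R * R) -> R) : continuous f ->
  continuous (fun z : state a b => f (set_val z)).
Proof.
by move=> cf z; apply: (@continuous_comp _ _ _ set_val f); [exact: set_val_continuous|exact: cf].
Qed.

(** The criterion with the Lyapunov function [k p(lam) + |E - e|]. *)
Lemma integral_stability (lam k e : R) (J : (R * R) * (R * R) -> R)
    (g : set (phase_space a b)) :
  continuous J -> reflection_invariant a b J ->
  (forall z : state a b, p_fun sigma a b 0 (set_val z) <= 0 ->
     0 <= k * p_fun sigma a b lam (set_val z)) ->
  (forall z : state a b, g (phase z) ->
     [/\ p_fun sigma a b lam (set_val z) = 0,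
         energy_fun sigma (set_val z) = e & 0 < J (set_val z)]) ->
  (forall z : state a b, p_fun sigma a b 0 (set_val z) <= 0 ->
     k * p_fun sigma a b lam (set_val z) = 0 ->
     energy_fun sigma (set_val z) = e ->
     0 <= J (set_val z) -> g (phase z)) ->
  orbitally_stable sigma g.
Proof.
move=> cJ iJ kp gP Pg.
pose H (y : (R * R) * (R * R)) :=
  k * p_fun sigma a b lam y + `|energy_fun sigma y - e|.
have cH : continuous H.
  move=> y; apply: cvgD.
    by apply: cvgM; [exact: cvg_cst|exact: p_fun_continuous].
  apply: cvg_norm; apply: cvgB; last exact: cvg_cst.
  exact: energy_fun_continuous.
apply: (@orbital_stability_criterion R a b sigma g (fun z => H (set_val z))
  (fun z => J (set_val z)) (2 * (e + 1)) a0 b0).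
- have -> : (fun z : state a b => p_integral sigma z 0) =
    (fun z => p_fun sigma a b 0 (set_val z)).
    by apply/funext => z; rewrite p_integralE.
  by apply: comp_set_val_continuous; exact: p_fun_continuous.
- move=> z1 z2 z12; rewrite !p_integralE.
  by apply: (invariant_set_val (@p_reflection R sigma a b 0 an0 bn0)).
- by move=> z t mz t0; rewrite !p_integralE p_conserved.
- exact: comp_set_val_continuous.
- apply: invariant_set_val => x v w xE vw; rewrite /H.
  by rewrite (p_reflection sigma lam an0 bn0 xE vw) (energy_reflection sigma xE vw).
- by move=> z t mz t0; rewrite /H p_conserved// energy_conserved.
- exact: comp_set_val_continuous.
- exact: invariant_set_val.
- by move=> z mz; exact: invariant_within_continuous mz.
- move=> z; rewrite p_integralE => /kp kp0; rewrite /H => H1.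
  have : `|energy_fun sigma (set_val z) - e| <= 1 by lra.
  rewrite ler_norml => /andP[_].
  have := mulr_ge0 (ltW s0) (sqr_ge0 (pos z).1).
  have := mulr_ge0 (ltW s0) (sqr_ge0 (pos z).2).
  by rewrite /energy_fun -/(vel z) -/(pos z) [dot (pos z) _]/dot; lra.
- by move=> z /gP[pz ez Jz]; rewrite /H pz ez subrr normr0 mulr0 addr0.
- move=> z; rewrite p_integralE /H => pz Jz Hz.
  have n0 := normr_ge0 (energy_fun sigma (set_val z) - e).
  have k0 := kp z pz.
  apply: Pg => //; first by lra.
  by apply/eqP; rewrite -subr_eq0 -normr_le0; lra.
Qed.

Lemma phase_orbit_rep (z : R -> state a b) (z0 : state a b) :
  phase_orbit z (phase z0) -> exists2 t, 0 <= t & same_phase (z t) z0.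
Proof. by move=> [t /=]; rewrite in_itv/= andbT => t0 /phaseP tz; exists t. Qed.

(** A sum of two nonnegative terms; the second one vanishes only on the y-axis. *)
Lemma p_at_a (y : (R * R) * (R * R)) : p_fun sigma a b a y =
  (y.2.2 * y.1.1 - y.2.1 * y.1.2) ^+ 2
  + (a - b) * (y.2.1 ^+ 2 + sigma * y.1.1 ^+ 2).
Proof. by rewrite /p_fun; ring. Qed.

Let e1_ge0 (u v : R) : 0 <= u ^+ 2 + sigma * v ^+ 2.
Proof.
by apply: addr_ge0; [|apply: mulr_ge0; first exact: ltW]; exact: sqr_ge0.
Qed.

Theorem y_axis_stable e (z : R -> state a b) : y_axis_motion sigma e z ->
  orbitally_stable sigma (phase_orbit z).
Proof.
move=> [bz ze ehi xi].
have e0 : 0 < e by apply: lt_le_trans ehi; rewrite divr_gt0// mulr_gt0.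
have mz : motion sigma z by left.
have [vi visit] := @axis_visits R a b sigma a0 b0 s0 true e z bz ze e0 xi.
have ab0 : 0 < a - b by rewrite subr_gt0.
apply: (@integral_stability a 1 e (cst 1)) => //.
- by move=> y; exact: cvg_cst.
- move=> z0 _; rewrite mul1r p_at_a; apply: addr_ge0; first exact: sqr_ge0.
  by apply: mulr_ge0; [exact: ltW|exact: e1_ge0].
- move=> z0 /phase_orbit_rep[t t0 tz]; split => //.
    rewrite -(invariant_set_val (p_reflection sigma a an0 bn0) tz) p_at_a.
    by rewrite -/(pos (z t)) -/(vel (z t)) xi// (vi t t0 : (vel (z t)).1 = 0); ring.
  rewrite -(invariant_set_val (@energy_reflection R sigma a b) tz).
  by rewrite energy_conserved// -energyE.
- move=> z0 _; rewrite mul1r p_at_a => pz ez _.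
  have h1 := sqr_ge0 ((set_val z0).2.2 * (set_val z0).1.1 - (set_val z0).2.1 * (set_val z0).1.2).
  have h3 := mulr_ge0 (ltW ab0) (e1_ge0 (set_val z0).2.1 (set_val z0).1.1).
  have : (a - b) * ((set_val z0).2.1 ^+ 2 + sigma * (set_val z0).1.1 ^+ 2) = 0 by lra.
  move/eqP; rewrite mulf_eq0 (gt_eqF ab0)/= paddr_eq0; last 2 first.
  - exact: sqr_ge0.
  - by apply: mulr_ge0; [exact: ltW|exact: sqr_ge0].
  rewrite sqrf_eq0 mulf_eq0 (gt_eqF s0)//= sqrf_eq0 => /andP[/eqP v0 /eqP x0].
  by apply: visit.
Qed.

End stable.

(** * Stability along the ellipse *)

Section limit.
Context {R : realType} {a b sigma : R}.
Hypotheses (b0 : 0 < b) (ab : b < a) (s0 : 0 < sigma).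

Let a0 : 0 < a. Proof. exact: lt_trans ab. Qed.
Let an0 : a != 0. Proof. by rewrite gt_eqF. Qed.
Let bn0 : b != 0. Proof. by rewrite gt_eqF. Qed.

(** Let [M] be the symmetric matrix with rows [(b - x2^2, x1 x2)] and
[(x1 x2, a - x1^2)], let [T] be its trace and [D] its determinant.  Inside the
ellipse [D >= 0].  The hypothesis [p(0) = 0] says [v . M v = sigma D], and the
energy bound says [sigma T <= |v|^2].  Cayley-Hamilton gives
[|M v|^2 = T (v . M v) - D |v|^2 <= 0], hence [M v = 0], then [D = 0]: the
point is on the ellipse, where [M v] is proportional to the normal part. *)
Lemma limit_level (x1 x2 v1 v2 e : R) : sigma * (a + b) / 2 <= e ->
  x1 ^+ 2 / a + x2 ^+ 2 / b <= 1 ->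
  p_fun sigma a b 0 ((x1, x2), (v1, v2)) = 0 ->
  energy_fun sigma ((x1, x2), (v1, v2)) = e ->
  x1 ^+ 2 / a + x2 ^+ 2 / b = 1 /\ x1 * v1 / a + x2 * v2 / b = 0.
Proof.
move=> elo xin; rewrite /p_fun /energy_fun /dot /= !subr0 => p0 eE.
pose D := a * b - b * x1 ^+ 2 - a * x2 ^+ 2.
have DE : D = a * b * (1 - (x1 ^+ 2 / a + x2 ^+ 2 / b)).
  by rewrite /D; field; rewrite an0 bn0.
have D0 : 0 <= D.
  by rewrite DE mulr_ge0 ?subr_ge0// ltW// mulr_gt0.
pose T := a + b - x1 ^+ 2 - x2 ^+ 2.
pose m1 := (b - x2 ^+ 2) * v1 + x1 * x2 * v2.
pose m2 := x1 * x2 * v1 + (a - x1 ^+ 2) * v2.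
have QE : v1 * m1 + v2 * m2 = sigma * D.
  by rewrite /m1 /m2 /D; lra.
have vE : sigma * T <= v1 ^+ 2 + v2 ^+ 2 by rewrite /T; lra.
have CH : m1 ^+ 2 + m2 ^+ 2 = T * (v1 * m1 + v2 * m2) - D * (v1 ^+ 2 + v2 ^+ 2).
  by rewrite /m1 /m2 /T /D; ring.
have mle : m1 ^+ 2 + m2 ^+ 2 <= 0.
  rewrite CH QE; have : 0 <= D * (v1 ^+ 2 + v2 ^+ 2 - sigma * T).
    by rewrite mulr_ge0// subr_ge0.
  by lra.
have m10 : m1 = 0 by apply/eqP; rewrite -sqrf_eq0; apply/eqP; nra.
have m20 : m2 = 0 by apply/eqP; rewrite -sqrf_eq0; apply/eqP; nra.
have Dz : D = 0.
  move/eqP: QE; rewrite m10 m20 !mulr0 addr0 eq_sym mulf_eq0 (gt_eqF s0)/=.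
  by move/eqP.
have xE : x1 ^+ 2 / a + x2 ^+ 2 / b = 1.
  move/eqP: DE; rewrite Dz eq_sym mulf_eq0 mulf_eq0 (gt_eqF a0) (gt_eqF b0)/=.
  by rewrite subr_eq0 => /eqP.
split=> //.
set n := (X in X = 0).
have e1 : x1 * n = 0.
  transitivity ((m1 - v1 * D / a) / b); last by rewrite m10 Dz mulr0 mul0r subr0 mul0r.
  by rewrite /n /m1 /D; field; rewrite an0 bn0.
have e2 : x2 * n = 0.
  transitivity ((m2 - v2 * D / b) / a); last by rewrite m20 Dz mulr0 mul0r subr0 mul0r.
  by rewrite /n /m2 /D; field; rewrite an0 bn0.
transitivity (x1 / a * (x1 * n) + x2 / b * (x2 * n)).
  by rewrite -[LHS]mul1r -xE; ring.
by rewrite e1 e2 !mulr0 addr0.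
Qed.

(** With [tangential_sq], a state of the limit level set is determined by its
position, energy and orientation. *)
Lemma tangent_velocity x v : tangent a b x v ->
  v.1 * normal_sq a b x = - (tangential a b (x, v) * x.2 / b) /\
  v.2 * normal_sq a b x = tangential a b (x, v) * x.1 / a.
Proof.
rewrite /tangent /normal_sq /tangential /= => t0; split.
  transitivity (- ((x.1 * v.2 / a - x.2 * v.1 / b) * x.2 / b) +
     x.1 / a * (x.1 * v.1 / a + x.2 * v.2 / b)); last by rewrite t0 mulr0 addr0.
  by field; rewrite an0 bn0.
transitivity ((x.1 * v.2 / a - x.2 * v.1 / b) * x.1 / a +
     x.2 / b * (x.1 * v.1 / a + x.2 * v.2 / b)); last by rewrite t0 mulr0 addr0.
by field; rewrite an0 bn0.
Qed.

Lemma tangential_sq x v : tangent a b x v ->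
  tangential a b (x, v) ^+ 2 = dot v v * normal_sq a b x.
Proof.
rewrite /tangent => t0.
transitivity (dot v v * normal_sq a b x - (x.1 * v.1 / a + x.2 * v.2 / b) ^+ 2).
  by rewrite /tangential /dot /normal_sq /=; field; rewrite an0 bn0.
by rewrite t0 expr0n subr0.
Qed.

Lemma limit_speed e x v : sigma * (a + b) / 2 <= e -> on_ellipse a b x ->
  dot v v = 2 * e - sigma * dot x x -> sigma * b <= dot v v.
Proof.
move=> elo; rewrite /on_ellipse => xE ->.
suff : dot x x <= a by move/(ler_wpM2l (ltW s0)); lra.
rewrite /dot -!expr2 -[leRHS]mulr1 -xE -subr_ge0.
have -> : a * (x.1 ^+ 2 / a + x.2 ^+ 2 / b) - (x.1 ^+ 2 + x.2 ^+ 2) =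
    (a - b) / b * x.2 ^+ 2 by field; rewrite an0 bn0.
by rewrite mulr_ge0 ?sqr_ge0// divr_ge0 ?ltW// subr_gt0.
Qed.

Lemma normal_sq_le x : on_ellipse a b x -> normal_sq a b x <= b^-1.
Proof.
rewrite /on_ellipse => xE; rewrite /normal_sq -[leRHS]mulr1 -xE -subr_ge0.
have -> : b^-1 * (x.1 ^+ 2 / a + x.2 ^+ 2 / b) -
    (x.1 ^+ 2 / a ^+ 2 + x.2 ^+ 2 / b ^+ 2) = (a - b) / b * (x.1 / a) ^+ 2.
  by field; rewrite an0 bn0.
by rewrite mulr_ge0 ?sqr_ge0// divr_ge0 ?ltW// subr_gt0.
Qed.

Variables (e : R) (z : R -> state a b).
Hypothesis lz : limit_motion sigma e z.

Let elo : sigma * (a + b) / 2 <= e. Proof. by case: lz. Qed.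
Let mz : motion sigma z. Proof. by right; exists e. Qed.
Let zE t : 0 <= t -> on_ellipse a b (pos (z t)).
Proof. by case: lz => _ _ _ h /h[]. Qed.
Let zt t : 0 <= t -> tangent a b (pos (z t)) (vel (z t)).
Proof. by case: lz => _ _ _ h /h[]. Qed.
Let zv t : 0 <= t -> dot (vel (z t)) (vel (z t)) = 2 * e - sigma * dot (pos (z t)) (pos (z t)).
Proof. by case: lz => _ _ _ h /h[]. Qed.

Let J t := tangential a b (set_val (z t)).
Let JE t : J t = tangential a b (pos (z t), vel (z t)).
Proof. by rewrite /J [set_val (z t)]surjective_pairing. Qed.

Let Jn0 t : 0 <= t -> J t != 0.
Proof.
move=> t0; rewrite -sqrf_eq0 JE tangential_sq; last exact: zt.
rewrite mulf_eq0 (gt_eqF (normal_sq_gt0 a0 b0 (zE t0))) orbF gt_eqF//.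
apply: lt_le_trans (limit_speed elo (zE t0) (zv t0)).
by rewrite mulr_gt0.
Qed.

(** The tangential component is continuous in time and never vanishes. *)
Lemma limit_orientation t : 0 <= t -> 0 < Num.sg (J 0) * J t.
Proof.
move=> t0; rewrite ltNge; apply/negP => Jt.
have J0 : 0 < Num.sg (J 0) * J 0 by rewrite -normrEsg normr_gt0 Jn0.
have [||c] := @IVT R (fun t => Num.sg (J 0) * J t) 0 t 0 t0.
- have cJ := invariant_within_continuous (@tangential_continuous R a b)
    (@tangential_reflection R a b) mz.
  have {}cJ : {within `[0, +oo[, continuous J} by exact: cJ.
  move=> x; apply: cvgM; first exact: cvg_cst.
  apply: continuous_subspaceW cJ x => x /=; rewrite !in_itv/=.
  by case/andP => ->.
- by rewrite ge_min le_max (ltW J0) Jt orbT.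
rewrite in_itv/= => /andP[c0 _] /eqP.
rewrite mulf_eq0 (negbTE (Jn0 c0)) orbF sgr_eq0 (negbTE (Jn0 _))//.
Qed.

(** In the coordinates [(x1 / sqrt a, x2 / sqrt b)] the motion runs along the
unit circle with an angular velocity of constant sign, bounded away from zero. *)
Lemma limit_sweep x0 : on_ellipse a b x0 -> exists2 t, 0 <= t & pos (z t) = x0.
Proof.
move=> x0E; apply: contrapT => nvisit.
pose sab := Num.sqrt (a * b).
have sab0 : 0 < sab by rewrite sqrtr_gt0 mulr_gt0.
have sab2 : sab ^+ 2 = a * b by rewrite sqr_sqrtr// ltW// mulr_gt0.
have sabn : sab != 0 by rewrite gt_eqF.
pose eps := Num.sg (J 0).
have eps2 : eps * eps = 1 by rewrite /eps -expr2 sqr_sg Jn0.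
pose X1 t := (set_val (z t)).1.1.
pose X2 t := (set_val (z t)).1.2.
pose c t := X1 t * x0.1 / a + X2 t * x0.2 / b.
pose s t := eps * (x0.1 * X2 t - x0.2 * X1 t) / sab.
pose q t := s t / (1 - c t).
have XE t : 0 <= t -> X1 t ^+ 2 / a + X2 t ^+ 2 / b = 1 by exact: zE.
have c1 t : 0 <= t -> c t < 1.
  move=> t0; rewrite -subr_gt0.
  have -> : 1 - c t = ((X1 t - x0.1) ^+ 2 / a + (X2 t - x0.2) ^+ 2 / b) / 2.
    transitivity (((X1 t ^+ 2 / a + X2 t ^+ 2 / b) + (x0.1 ^+ 2 / a + x0.2 ^+ 2 / b)) / 2 - c t).
      by rewrite XE// x0E; field.
    by rewrite /c; field; rewrite an0 bn0.
  have h1 : 0 <= (X1 t - x0.1) ^+ 2 / a by rewrite divr_ge0 ?sqr_ge0 ?ltW.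
  have h2 : 0 <= (X2 t - x0.2) ^+ 2 / b by rewrite divr_ge0 ?sqr_ge0 ?ltW.
  apply: divr_gt0 => //; rewrite lt_def addr_ge0// andbT paddr_eq0//.
  rewrite !mulf_eq0 !invr_eq0 (gt_eqF a0) (gt_eqF b0) !orbF !subr_eq0 !orbb.
  apply/negP => /andP[/eqP e1 /eqP e2]; apply: nvisit; exists t => //.
  by rewrite [x0]surjective_pairing -e1 -e2 [LHS]surjective_pairing.
have qcont (F : set_system R) (FF : Filter F) t : 0 <= t -> X1 @ F --> X1 t ->
    X2 @ F --> X2 t -> q @ F --> q t.
  move=> t0 c1' c2'; apply: cvgM; first by rewrite /s; cvg_poly.
  apply: cvgV; first by rewrite gt_eqF// subr_gt0 c1.
  by rewrite /c; cvg_poly.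
pose k0 := Num.sqrt sigma * b / sab.
have k00 : 0 < k0 by rewrite divr_gt0// mulr_gt0// sqrtr_gt0.
apply: (@atan_decay_absurd R q (k0 / 2)) => //.
- by rewrite divr_gt0.
- move=> t t0; have zr := motion_right mz t0.
  apply: qcont => //.
    exact (cvg_fst_of _ (cvg_fst_of _ zr)).
  exact (cvg_snd_of _ (cvg_fst_of _ zr)).
- move=> t t0; have [w zl _] := motion_left mz t0; exists (q t) => //.
  apply: qcont; first exact: ltW.
    exact (cvg_fst_of _ (cvg_fst_of _ zl)).
  exact (cvg_snd_of _ (cvg_fst_of _ zl)).
move=> T T0; exists [::] => t /andP[t0 tT] _.
have [_ _ dx _] := lz; have /is_derive_pairP[dx1 dx2] := dx t t0.
have {}dx1 : is_derive t 1 X1 (vel (z t)).1 by exact: dx1.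
have {}dx2 : is_derive t 1 X2 (vel (z t)).2 by exact: dx2.
have t0' := ltW t0.
have n0 := normal_sq_gt0 a0 b0 (zE t0').
pose k := J t / normal_sq a b (pos (z t)).
have [v1E v2E] := tangent_velocity (zt t0').
have nn : normal_sq a b (pos (z t)) != 0 by rewrite gt_eqF.
have {}v1E : (vel (z t)).1 = - (k * X2 t / b).
  rewrite -[LHS](mulfK nn) v1E /k JE /X2 -/(pos (z t)).
  by field; rewrite nn bn0.
have {}v2E : (vel (z t)).2 = k * X1 t / a.
  rewrite -[LHS](mulfK nn) v2E /k JE /X1 -/(pos (z t)).
  by field; rewrite nn an0.
pose om := eps * k / sab.
have dc : is_derive t 1 c (- (om * s t)).
  rewrite /c; eapply is_derive_eq; [derive_poly|rewrite /GRing.scale/=].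
  rewrite v1E v2E /om /s.
  (* [eps] has square one and [sab] has square [a b] *)
  transitivity (- ((eps * eps) * k * (x0.1 * X2 t - x0.2 * X1 t) / sab ^+ 2)).
    by rewrite eps2 sab2; field; rewrite an0 bn0.
  by field.
have ds : is_derive t 1 s (om * c t).
  rewrite /s; eapply is_derive_eq; [derive_poly|rewrite /GRing.scale/=].
  by rewrite v1E v2E /om /c; field; rewrite an0 bn0 sabn.
have cs1 : c t ^+ 2 + s t ^+ 2 = 1.
  transitivity ((X1 t ^+ 2 / a + X2 t ^+ 2 / b) * (x0.1 ^+ 2 / a + x0.2 ^+ 2 / b)).
    rewrite /c /s expr_div_n sab2 exprMn [eps ^+ 2]expr2 eps2.
    by field; rewrite an0 bn0.
  by rewrite XE// x0E mulr1.
exists (- (om / 2)).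
  exact: is_derive_half_angle dc ds cs1 (c1 t t0').
rewrite lerN2 ler_pM2r// /om /k0 ler_pM2r ?invr_gt0//.
have ek : 0 < eps * k.
  by rewrite /k mulrA divr_gt0//; exact: limit_orientation.
rewrite -(@ler_pXn2r _ 2)// ?nnegrE ?(ltW ek)//; last first.
  by rewrite mulr_ge0 ?sqrtr_ge0// ltW.
have -> : (eps * k) ^+ 2 = dot (vel (z t)) (vel (z t)) / normal_sq a b (pos (z t)).
  rewrite exprMn [eps ^+ 2]expr2 eps2 mul1r /k expr_div_n JE tangential_sq.
    by field.
  exact: zt.
rewrite exprMn sqr_sqrtr ?(ltW s0)//.
rewrite ler_pdivlMr//; apply: le_trans (limit_speed elo (zE t0') (zv t0')).
have := ler_wpM2l (mulr_ge0 (ltW s0) (sqr_ge0 b)) (normal_sq_le (zE t0')).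
by move/le_trans; apply; rewrite expr2 mulrA mulfK.
Qed.

Lemma limit_visits (z0 : state a b) : on_ellipse a b (pos z0) ->
  tangent a b (pos z0) (vel z0) -> energy_fun sigma (set_val z0) = e ->
  0 < Num.sg (J 0) * tangential a b (set_val z0) -> phase_orbit z (phase z0).
Proof.
move=> x0E v0t ez J0.
have [t t0 xt] := limit_sweep x0E.
exists t; first by rewrite /= in_itv/= t0.
suff vt : vel (z t) = vel z0.
  congr phase; apply: val_inj.
  rewrite [LHS]surjective_pairing [RHS]surjective_pairing.
  by move: xt vt; rewrite /pos /vel set_valE => -> ->.
have nn : normal_sq a b (pos z0) != 0 by rewrite gt_eqF// (normal_sq_gt0 a0 b0).
have JJ : tangential a b (pos (z t), vel (z t)) = tangential a b (pos z0, vel z0).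
  have eps0 : Num.sg (J 0) != 0 by rewrite sgr_eq0 Jn0.
  apply: (mulfI eps0).
  have p1 := limit_orientation t0; rewrite JE in p1.
  have p2 : 0 < Num.sg (J 0) * tangential a b (pos z0, vel z0).
    by move: J0; rewrite [set_val z0]surjective_pairing.
  apply/eqP; rewrite -(@eqrXn2 _ 2)// ?ltW// !exprMn; apply/eqP; congr (_ * _).
  rewrite tangential_sq; last exact: zt.
  rewrite tangential_sq; last exact: v0t.
  rewrite zv// xt; congr (_ * _).
  by rewrite -ez /energy_fun -/(pos z0) -/(vel z0); field.
have [v1 v2] := tangent_velocity (zt t0).
have [w1 w2] := tangent_velocity v0t.
rewrite [LHS]surjective_pairing [RHS]surjective_pairing; congr pair.
  by apply: (mulIf nn); rewrite w1 -{1}xt v1 JJ xt.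
by apply: (mulIf nn); rewrite w2 -{1}xt v2 JJ xt.
Qed.

Theorem limit_stable : orbitally_stable sigma (phase_orbit z).
Proof.
pose eps := Num.sg (J 0).
have iJ : reflection_invariant a b (fun y => eps * tangential a b y).
  by move=> x v w xE vw; rewrite (tangential_reflection xE vw).
apply: (@integral_stability R a b sigma b0 ab s0 0 (-1) e (fun y => eps * tangential a b y)) => //.
- by move=> y; apply: cvgM; [exact: cvg_cst|exact: tangential_continuous].
- by move=> z0; rewrite mulN1r oppr_ge0.
- move=> z0 /phase_orbit_rep[t t0 tz]; split.
  + rewrite -(invariant_set_val (p_reflection sigma 0 an0 bn0) tz).
    rewrite [set_val _]surjective_pairing p_fun0_ellipse//; last exact: zE.
    by have := zt t0; rewrite /tangent /normal_part /= => ->; rewrite expr0n mulr0 oppr0.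
  + rewrite -(invariant_set_val (@energy_reflection R sigma a b) tz).
    by rewrite /energy_fun -/(pos (z t)) -/(vel (z t)) zv//; field.
  + by rewrite -(invariant_set_val iJ tz); exact: limit_orientation.
- move=> z0 _ /eqP; rewrite mulN1r oppr_eq0 => /eqP pz ez Jz.
  have zin := state_inside z0.
  have zz : set_val z0 = (((pos z0).1, (pos z0).2), ((vel z0).1, (vel z0).2)).
    by rewrite /pos /vel; case: (set_val z0) => [[? ?] [? ?]].
  have [x0E v0t] : on_ellipse a b (pos z0) /\ tangent a b (pos z0) (vel z0).
    by move: pz ez; rewrite zz => pz ez; exact: limit_level elo zin pz ez.
  apply: limit_visits => //; rewrite lt_def Jz andbT.
  rewrite mulf_eq0 sgr_eq0 (negbTE (Jn0 _))//= -sqrf_eq0.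
  rewrite [set_val z0]surjective_pairing tangential_sq//.
  rewrite mulf_eq0 (gt_eqF (normal_sq_gt0 a0 b0 x0E)) orbF gt_eqF//.
  apply: (@lt_le_trans _ _ (sigma * b)); first by rewrite mulr_gt0.
  apply: (limit_speed elo x0E).
  by rewrite -ez /energy_fun -/(pos z0) -/(vel z0); field.
Qed.
End limit.

(** * The bounce map *)

Section bounce.
Context {R : realType}.
Implicit Types (x : R * R) (y : (R * R) * (R * R)) (t : R).

(** A point [(c, s)] of the first quadrant, close to the first axis, is rotated
by an angle of cosine [K] and sine [D], at most a right angle.  If the image
is close to the first axis as well, it cannot have passed into the second
quadrant, and its height has increased by a definite amount. *)
Lemma rotation_growth (c s K D eta : R) : eta <= 2^-1 ->
  c ^+ 2 + s ^+ 2 = 1 -> K ^+ 2 + D ^+ 2 = 1 -> 0 <= K -> 0 < D ->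
  0 < c -> 0 <= s < eta -> `|K * s + D * c| < eta ->
  0 < K * c - D * s /\ s + D / 4 <= K * s + D * c.
Proof.
move=> eta2 cs KD K0 D0 c0 /andP[s0 seta]; rewrite ltr_norml => /andP[s'lo s'hi].
have s2 : s ^+ 2 <= 2^-1 ^+ 2 by rewrite ler_pXn2r ?nnegrE//; lra.
have c34 : 3 / 4 <= c by rewrite -(@ler_pXn2r _ 2)// ?nnegrE//; lra.
have K1 : K <= 1 by rewrite -(@ler_pXn2r _ 2)// ?nnegrE//; have := sqr_ge0 D; lra.
have D1 : D <= 1 by rewrite -(@ler_pXn2r _ 2)// ?nnegrE//; have := sqr_ge0 K; lra.
split.
  rewrite ltNge; apply/negP => c'0.
  have c'1 : (K * c - D * s) ^+ 2 + (K * s + D * c) ^+ 2 = 1.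
    transitivity ((K ^+ 2 + D ^+ 2) * (c ^+ 2 + s ^+ 2)); first by ring.
    by rewrite KD cs mulr1.
  have h1 : (K * s + D * c) ^+ 2 <= 2^-1 ^+ 2.
    rewrite -[leLHS]real_normK ?num_real// ler_pXn2r ?nnegrE//.
    by rewrite ler_norml; lra.
  have h2 : - 2^-1 <= K * c - D * s.
    have := mulr_ge0 K0 (ltW c0); have : D * s <= 1 * s by rewrite ler_wpM2r.
    by lra.
  have h3 : (K * c - D * s) ^+ 2 <= 2^-1 ^+ 2.
    rewrite -[leLHS]real_normK ?num_real// ler_pXn2r ?nnegrE//.
    by rewrite ler_norml; lra.
  by lra.
have h1 : D ^+ 2 <= D * 1 by rewrite expr2 ler_wpM2l// ltW.
have h2 : K ^+ 2 <= K * 1 by rewrite expr2 ler_wpM2l.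
have h3 : s * (1 - K) <= s * D by rewrite ler_wpM2l//; lra.
have h4 : D * (4^-1) <= D * (c - s) by rewrite ler_wpM2l// ?ltW//; lra.
by lra.
Qed.

Lemma sin_le t : 0 <= t -> sin t <= t.
Proof.
move=> t0; rewrite -subr_ge0.
have d (s : R) : is_derive s 1 (fun s => s - sin s) (1 - cos s) by exact: is_deriveBp.
have : 0 - sin 0 <= t - sin t; last by rewrite sin0 subr0.
apply: (@ger0_derive1_le_cc R (fun s => s - sin s) 0 t); rewrite ?in_itv/= ?lexx ?t0//.
- by move=> s _; rewrite derive1E; have [_ ->] := d s; rewrite subr_ge0 cos_le1.
- apply: continuous_subspaceT => s; apply: differentiable_continuous.
  by apply/derivable1_diffP; have [] := d s.
Qed.

(** Free motion with angle [t] of a state [(x, q)], where [q] is the velocity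
divided by the frequency. *)
Definition rot t y : (R * R) * (R * R) :=
  ((cos t * y.1.1 + sin t * y.2.1, cos t * y.1.2 + sin t * y.2.2),
   (- sin t * y.1.1 + cos t * y.2.1, - sin t * y.1.2 + cos t * y.2.2)).

Definition angular y : R := y.1.1 * y.2.2 - y.1.2 * y.2.1.
Definition total y : R := dot y.1 y.1 + dot y.2 y.2.

Lemma angular_rot t y : angular (rot t y) = angular y.
Proof.
transitivity ((cos t ^+ 2 + sin t ^+ 2) * angular y).
  by rewrite /angular /rot /=; ring.
by rewrite cos2Dsin2 mul1r.
Qed.

Lemma total_rot t y : total (rot t y) = total y.
Proof.
transitivity ((cos t ^+ 2 + sin t ^+ 2) * total y).
  by rewrite /total /dot /rot /=; ring.
by rewrite cos2Dsin2 mul1r.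
Qed.

Lemma rot0 y : rot 0 y = y.
Proof.
rewrite /rot cos0 sin0 oppr0 !mul1r !mul0r !addr0 !add0r.
by case: y => [[? ?] [? ?]].
Qed.

Context {a b : R}.
Hypotheses (a0 : 0 < a) (b0 : 0 < b).
Let an0 : a != 0. Proof. by rewrite gt_eqF. Qed.
Let bn0 : b != 0. Proof. by rewrite gt_eqF. Qed.
Variable m : R.
Hypothesis m0 : 0 < m.

(** States leaving the ellipse; by [p_fun0_ellipse] a single [m] serves for all
the bounces of a motion. *)
Definition outgoing y := on_ellipse a b y.1 /\ normal_part a b y = - m.
Definition speed y : R := y.2.1 ^+ 2 / a + y.2.2 ^+ 2 / b.
(** Along the flight of an outgoing state, the gauge [x1^2 / a + x2^2 / b - 1] is
[sin t ((speed - 1) sin t - 2 m cos t)]; this is the amplitude of its second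
factor. *)
Definition amplitude y : R := Num.sqrt ((speed y - 1) ^+ 2 + 4 * m ^+ 2).
(** The first positive zero of the gauge, see [gauge_rot]. *)
Definition flight y : R := acos ((speed y - 1) / amplitude y).

Lemma amplitude_sq y : amplitude y ^+ 2 = (speed y - 1) ^+ 2 + 4 * m ^+ 2.
Proof.
rewrite sqr_sqrtr//; apply: addr_ge0; first exact: sqr_ge0.
by apply: mulr_ge0 => //; exact: sqr_ge0.
Qed.

Lemma amplitude_gt0 y : 0 < amplitude y.
Proof.
rewrite sqrtr_gt0; have := sqr_ge0 (speed y - 1).
by have : 0 < m ^+ 2 := exprn_gt0 _ m0; lra.
Qed.

Lemma flight_trig y : [/\ cos (flight y) = (speed y - 1) / amplitude y,
  sin (flight y) = 2 * m / amplitude y & 0 < flight y < pi].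
Proof.
have A0 := amplitude_gt0 y; have An0 : amplitude y != 0 by rewrite gt_eqF.
pose q := (speed y - 1) / amplitude y.
have q2 : q ^+ 2 + (2 * m / amplitude y) ^+ 2 = 1.
  rewrite /q !expr_div_n -mulrDl exprMn.
  have -> : 2 ^+ 2 = 4 :> R by ring.
  by rewrite -amplitude_sq divff// expf_neq0.
have S0 : 0 < 2 * m / amplitude y by rewrite divr_gt0// mulr_gt0.
have S20 : 0 < (2 * m / amplitude y) ^+ 2 by rewrite exprn_gt0.
have q1 : -1 < q < 1.
  rewrite -ltr_norml -(@ltr_pXn2r _ 2)// ?nnegrE// real_normK ?num_real//; lra.
have q1' : -1 <= q <= 1 by case/andP: q1 => ? ?; rewrite !ltW.
have cq : cos (acos q) = q by rewrite acosK.
split; first exact: cq.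
  rewrite /flight sin_acos// -/q.
  have -> : 1 - q ^+ 2 = (2 * m / amplitude y) ^+ 2 by lra.
  by rewrite sqrtr_sqr gtr0_norm.
by case/andP: q1 => ? ?; rewrite /flight -/q acos_gt0 ?acos_ltpi//; lra.
Qed.

Lemma gauge_rot y t : outgoing y ->
  (rot t y).1.1 ^+ 2 / a + (rot t y).1.2 ^+ 2 / b - 1 =
  - (amplitude y * sin t * sin (flight y - t)).
Proof.
move=> [yE yn]; have [cE sE _] := flight_trig y.
have An0 : amplitude y != 0 by rewrite gt_eqF// amplitude_gt0.
rewrite sinB cE sE.
transitivity (cos t ^+ 2 * (y.1.1 ^+ 2 / a + y.1.2 ^+ 2 / b)
   + 2 * sin t * cos t * normal_part a b y + sin t ^+ 2 * speed y
   - (cos t ^+ 2 + sin t ^+ 2)).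
  rewrite cos2Dsin2 /rot /normal_part /speed /=.
  by field; rewrite an0 bn0.
rewrite yE yn; field; exact: An0.
Qed.

Lemma flight_inside y t : outgoing y -> 0 < t < flight y ->
  (rot t y).1.1 ^+ 2 / a + (rot t y).1.2 ^+ 2 / b < 1.
Proof.
move=> yo /andP[t0 tf]; rewrite -subr_lt0 gauge_rot// oppr_lt0.
have [_ _ /andP[_ fpi]] := flight_trig y.
apply: mulr_gt0; first apply: mulr_gt0; first exact: amplitude_gt0.
  by apply: sin_gt0_pi; rewrite t0 (lt_trans tf).
by apply: sin_gt0_pi; apply/andP; split; lra.
Qed.

Lemma flight_end y : outgoing y -> on_ellipse a b (rot (flight y) y).1 /\
  normal_part a b (rot (flight y) y) = m.
Proof.
move=> yo; split.
  apply/eqP; rewrite -subr_eq0 gauge_rot// subrr sin0 mulr0 oppr0.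
  exact: eqxx.
have [yE yn] := yo; have [cE sE _] := flight_trig y.
have An0 : amplitude y != 0 by rewrite gt_eqF// amplitude_gt0.
transitivity (cos (flight y) * sin (flight y) * (speed y - (y.1.1 ^+ 2 / a + y.1.2 ^+ 2 / b))
  + (cos (flight y) ^+ 2 - sin (flight y) ^+ 2) * normal_part a b y).
  by rewrite /rot /normal_part /speed /=; field; rewrite an0 bn0.
rewrite yE yn cE sE.
transitivity (m * ((speed y - 1) ^+ 2 + 4 * m ^+ 2) / amplitude y ^+ 2).
  by field; exact: An0.
by rewrite -amplitude_sq mulfK// expf_neq0.
Qed.

(** The multiple of the normal vector to be subtracted in order to change the
normal part from [m] to [- m]. *)
Definition kick y : R := 2 * m / normal_sq a b y.1.
Definition reflect y : (R * R) * (R * R) :=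
  (y.1, (y.2.1 - kick y * (y.1.1 / a), y.2.2 - kick y * (y.1.2 / b))).
Definition next y := reflect (rot (flight y) y).


Lemma next_outgoing y : outgoing y -> outgoing (next y).
Proof.
move=> yo; have [yE yn] := flight_end yo; split; first exact: yE.
rewrite /next; move: (rot (flight y) y) yE yn => {yo}y' yE yn.
have nn : normal_sq a b y'.1 != 0 by rewrite gt_eqF// normal_sq_gt0.
transitivity (normal_part a b y' - kick y' * normal_sq a b y'.1).
  by rewrite /normal_part /normal_sq /reflect /=; field; rewrite an0 bn0.
by rewrite yn /kick mulfVK//; ring.
Qed.

Lemma next_reflected y (o : R) : outgoing y ->
  reflected a b (next y).1 (o *: (rot (flight y) y).2) (o *: (next y).2).
Proof.
move=> yo; have [yE yn] := flight_end yo; have [_ nn] := next_outgoing yo.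
rewrite /next in nn *; move: (rot (flight y) y) yE yn nn => {yo}y' yE yn nn.
split.
  rewrite /tangent; transitivity (o * (normal_part a b y' + normal_part a b (reflect y'))).
    by rewrite /normal_part /= /GRing.scale/=; field; rewrite an0 bn0.
  by rewrite yn nn subrr mulr0.
move=> u; rewrite /tangent /dot /= /GRing.scale/= => u0.
transitivity (o * kick y' * (y'.1.1 * u.1 / a + y'.1.2 * u.2 / b)).
  by field; rewrite an0 bn0.
by rewrite u0 mulr0.
Qed.

Lemma total_next y : outgoing y -> total (next y) = total y.
Proof.
move=> yo; have [yE yn] := flight_end yo.
rewrite -(total_rot (flight y) y) /next.
move: (rot (flight y) y) yE yn => {yo}y' yE yn.
have nn : normal_sq a b y'.1 != 0 by rewrite gt_eqF// normal_sq_gt0.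
transitivity (total y' - kick y' * (2 * normal_part a b y' - kick y' * normal_sq a b y'.1)).
  by rewrite /total /dot /normal_part /normal_sq /reflect /=; field; rewrite an0 bn0.
by rewrite yn /kick mulfVK//; ring.
Qed.

Lemma angular_next y : angular (next y) =
  angular y - kick (rot (flight y) y) * ((a - b) / (a * b)) * ((next y).1.1 * (next y).1.2).
Proof.
rewrite -(angular_rot (flight y) y) /next /angular /reflect /=.
by field; rewrite an0 bn0.
Qed.

Lemma kick_ge0 y : 0 <= kick y.
Proof.
rewrite /kick divr_ge0//; first by rewrite mulr_ge0// ltW.
rewrite /normal_sq -!expr_div_n; apply: addr_ge0; exact: sqr_ge0.
Qed.

(** The angular momentum in the coordinates where the ellipse is a circle. *)
Definition slope y : R := angular y / (Num.sqrt a * Num.sqrt b).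

Let al := Num.sqrt a.
Let be := Num.sqrt b.
Let al0 : 0 < al. Proof. by rewrite sqrtr_gt0. Qed.
Let be0 : 0 < be. Proof. by rewrite sqrtr_gt0. Qed.
Let aln : al != 0. Proof. by rewrite gt_eqF. Qed.
Let ben : be != 0. Proof. by rewrite gt_eqF. Qed.
Let aE : a = al ^+ 2. Proof. by rewrite sqr_sqrtr// ltW. Qed.
Let bE : b = be ^+ 2. Proof. by rewrite sqr_sqrtr// ltW. Qed.

(** In the coordinates where the ellipse is the unit circle, the velocity has
radial component [- m] and angular component [slope y]. *)
Lemma outgoing_scaled y : outgoing y ->
  [/\ (y.1.1 / al) ^+ 2 + (y.1.2 / be) ^+ 2 = 1,
      y.2.1 / al = - m * (y.1.1 / al) - slope y * (y.1.2 / be),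
      y.2.2 / be = - m * (y.1.2 / be) + slope y * (y.1.1 / al) &
      speed y = m ^+ 2 + slope y ^+ 2].
Proof.
move=> [yE yn].
have uE : (y.1.1 / al) ^+ 2 + (y.1.2 / be) ^+ 2 = 1.
  by rewrite !expr_div_n -aE -bE.
have wn : (y.1.1 / al) * (y.2.1 / al) + (y.1.2 / be) * (y.2.2 / be) = - m.
  rewrite -yn /normal_part aE bE.
  by field; rewrite aln ben.
have jE : slope y = (y.1.1 / al) * (y.2.2 / be) - (y.1.2 / be) * (y.2.1 / al).
  by rewrite /slope /angular -/al -/be; field; rewrite aln ben.
have sE : speed y = (y.2.1 / al) ^+ 2 + (y.2.2 / be) ^+ 2.
  by rewrite /speed !expr_div_n -aE -bE.
move: uE wn jE sE; move: (y.1.1 / al) (y.1.2 / be) (y.2.1 / al) (y.2.2 / be).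
move=> u1 u2 w1 w2 uE wn jE sE; split => //.
- rewrite -wn jE -[LHS]mulr1 -uE; ring.
- rewrite -wn jE -[LHS]mulr1 -uE; ring.
- rewrite sE jE -[LHS]mulr1 -[X in _ * X]uE -[m]opprK -wn; ring.
Qed.

(** Near the axis the tangential velocity controls the slope, and a slope bounded
in this way means that a flight turns the point, seen up to the central
symmetry, by at most a right angle. *)
Lemma slope_small y eta : outgoing y -> b < a -> eta = b / (2 * a) ->
  `|y.1.2 / be| < eta -> `|al * be * tangential a b y| < b / 2 ->
  slope y ^+ 2 <= 1 + m ^+ 2.
Proof.
move=> yo ab etaE u2 J.
have [uE w1E w2E _] := outgoing_scaled yo.
have : al * be * tangential a b y = slope y * (b * (y.1.1 / al) ^+ 2 + a * (y.1.2 / be) ^+ 2)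
    + m * (a - b) * ((y.1.1 / al) * (y.1.2 / be)).
  transitivity (b * ((y.1.1 / al) * (y.2.2 / be)) - a * ((y.1.2 / be) * (y.2.1 / al))).
    by rewrite /tangential aE bE; field; rewrite aln ben.
  by rewrite w1E w2E; ring.
move: (y.1.1 / al) (y.1.2 / be) uE u2 {w1E w2E} => u1 u2 uE u2s JE.
rewrite leNgt; apply/negP => j2.
have j1 : 1 < `|slope y|.
  rewrite -(@ltr_pXn2r _ 2)// ?nnegrE// expr1n real_normK ?num_real//.
  by have := sqr_ge0 m; lra.
have jm : m < `|slope y|.
  rewrite -(@ltr_pXn2r _ 2)// ?nnegrE// ?(ltW m0)// real_normK ?num_real//.
  by lra.
have ab0 : 0 < a - b by rewrite subr_gt0.
have h1 : b <= b * u1 ^+ 2 + a * u2 ^+ 2.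
  rewrite -[leLHS]mulr1 -uE; have := mulr_ge0 (ltW ab0) (sqr_ge0 u2).
  by lra.
have u11 : `|u1| <= 1.
  rewrite -(@ler_pXn2r _ 2)// ?nnegrE// real_normK ?num_real//.
  by have := sqr_ge0 u2; lra.
have h2 : `|m * (a - b) * (u1 * u2)| <= `|slope y| * (b / 2).
  rewrite normrM [`|m * (a - b)|]gtr0_norm ?mulr_gt0// -mulrA.
  apply: ler_pM; [exact: ltW|by apply: mulr_ge0 => //; exact: ltW| exact: ltW|].
  apply: (@le_trans _ _ (a * (1 * eta))).
    apply: ler_pM; [exact: ltW|exact: normr_ge0|by move: b0; lra|].
    by rewrite normrM ler_pM// ltW.
  by rewrite etaE (_ : a * _ = b / 2)//; field; rewrite an0.
have h3 : `|slope y| * b <= `|slope y * (b * u1 ^+ 2 + a * u2 ^+ 2)|.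
  rewrite [leRHS]normrM ler_wpM2l// (le_trans h1)// ler_norm.
  by [].
have h4 := ler_normB (slope y * (b * u1 ^+ 2 + a * u2 ^+ 2) + m * (a - b) * (u1 * u2))
   (m * (a - b) * (u1 * u2)).
rewrite addrK -JE in h4.
have h5 : 1 * (b / 2) < `|slope y| * (b / 2) by rewrite ltr_pM2r// divr_gt0.
by lra.
Qed.

(** In the scaled coordinates the flight sends the point [u] to the opposite of
its rotation by the angle of cosine [(1 + m^2 - j^2) / amplitude] and sine
[- 2 m j / amplitude], where [j] is the slope.  The sign [eps] keeps track of
the central symmetries.  In the first quadrant the reflection cannot increase
the angular momentum, by [angular_next]. *)
Lemma next_growth y (eps l eta : R) : outgoing y -> b < a -> 0 < l ->
  eps * eps = 1 -> slope y <= - l -> slope y ^+ 2 <= 1 + m ^+ 2 -> eta <= 2^-1 ->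
  0 < eps * (y.1.1 / al) -> 0 <= eps * (y.1.2 / be) ->
  `|y.1.2 / be| < eta -> `|(next y).1.2 / be| < eta ->
  [/\ 0 < - eps * ((next y).1.1 / al),
      eps * (y.1.2 / be) + m * l / (1 + m ^+ 2) / 4 <= - eps * ((next y).1.2 / be) &
      slope (next y) <= - l].
Proof.
move=> yo ab l0 eps2 jl jm eta2 c0 s0 su s'u.
have [cE sE _] := flight_trig y; have A0 := amplitude_gt0 y.
have An0 : amplitude y != 0 by rewrite gt_eqF.
have m2 : 0 < 1 + m ^+ 2 by have := sqr_ge0 m; lra.
have [uE w1E w2E spE] := outgoing_scaled yo.
have [j jE] : exists j, slope y = j by exists (slope y).
rewrite jE in jl jm w1E w2E spE.
pose K := (1 + m ^+ 2 - j ^+ 2) / amplitude y.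
pose D := - (2 * m * j / amplitude y).
have K0 : 0 <= K by rewrite divr_ge0 ?subr_ge0// ltW.
have D0 : 0 < D.
  by rewrite /D -mulNr divr_gt0// -mulrN mulr_gt0 ?mulr_gt0//; lra.
have KD : K ^+ 2 + D ^+ 2 = 1.
  rewrite /K /D sqrrN !expr_div_n -mulrDl.
  rewrite (_ : (1 + m ^+ 2 - j ^+ 2) ^+ 2 + (2 * m * j) ^+ 2 =
    (m ^+ 2 + j ^+ 2 - 1) ^+ 2 + 4 * m ^+ 2); last by ring.
  by rewrite -spE -amplitude_sq divff// expf_neq0.
pose c := eps * (y.1.1 / al); pose s := eps * (y.1.2 / be).
have eps2' : eps ^+ 2 = 1 by rewrite expr2.
have cs : c ^+ 2 + s ^+ 2 = 1 by rewrite /c /s ![(eps * _) ^+ 2]exprMn eps2' !mul1r.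
have cE' : - eps * ((next y).1.1 / al) = K * c - D * s.
  rewrite /next /reflect /rot /= cE sE spE.
  transitivity (- eps * ((m ^+ 2 + j ^+ 2 - 1) / amplitude y * (y.1.1 / al)
     + 2 * m / amplitude y * (y.2.1 / al))); first by field; rewrite An0 aln.
  by rewrite w1E /c /s /K /D; field; rewrite An0 aln ben.
have sE' : - eps * ((next y).1.2 / be) = K * s + D * c.
  rewrite /next /reflect /rot /= cE sE spE.
  transitivity (- eps * ((m ^+ 2 + j ^+ 2 - 1) / amplitude y * (y.1.2 / be)
     + 2 * m / amplitude y * (y.2.2 / be))); first by field; rewrite An0 ben.
  by rewrite w2E /c /s /K /D; field; rewrite An0 aln ben.
have epsn : `|eps| = 1.
  by apply/eqP; rewrite -(@eqrXn2 _ 2)// real_normK ?num_real// eps2' expr1n.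
have [||c'0 s'D] := @rotation_growth c s K D eta eta2 cs KD K0 D0 c0.
- by rewrite s0 (le_lt_trans (ler_norm _))// normrM epsn mul1r.
- by rewrite -sE' normrM normrN epsn mul1r.
have AM : amplitude y <= 2 * (1 + m ^+ 2).
  rewrite -(@ler_pXn2r _ 2)// ?nnegrE ?(ltW A0)//; last by rewrite mulr_ge0// ltW.
  rewrite amplitude_sq spE.
  have h1 : `|m ^+ 2 + j ^+ 2 - 1| <= 1 + 2 * m ^+ 2.
    by rewrite ler_norml; have := sqr_ge0 m; have := sqr_ge0 j; lra.
  have h2 : (m ^+ 2 + j ^+ 2 - 1) ^+ 2 <= (1 + 2 * m ^+ 2) ^+ 2.
    rewrite -[leLHS]real_normK ?num_real// ler_pXn2r// ?nnegrE//.
    by have := sqr_ge0 m; lra.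
  by have := sqr_ge0 m; lra.
have Dl : m * l / (1 + m ^+ 2) <= D.
  rewrite /D -mulNr ler_pdivlMr// mulrAC ler_pdivrMr//.
  apply: (@le_trans _ _ (m * l * (2 * (1 + m ^+ 2)))).
    by rewrite ler_wpM2l// mulr_ge0// ltW.
  have : m * l * (1 + m ^+ 2) <= m * (- j) * (1 + m ^+ 2).
    by rewrite ler_wpM2r ?(ltW m2)// ler_wpM2l ?(ltW m0)//; lra.
  by lra.
rewrite cE' sE'; split => //; first by rewrite -/s; lra.
apply: le_trans jl; rewrite -jE /slope ler_pM2r; last by rewrite invr_gt0 mulr_gt0.
rewrite angular_next lerBlDr lerDl; apply: mulr_ge0.
  apply: mulr_ge0; first exact: kick_ge0.
  by rewrite divr_ge0 ?subr_ge0 ?mulr_ge0 ?ltW.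
have -> : (next y).1.1 * (next y).1.2 = al * be *
    ((- eps * ((next y).1.1 / al)) * (- eps * ((next y).1.2 / be))).
  transitivity ((eps * eps) * ((next y).1.1 * (next y).1.2)).
    by rewrite eps2 mul1r.
  by field; rewrite aln ben.
rewrite cE' sE'; apply: mulr_ge0; first by rewrite mulr_ge0// ltW.
apply: mulr_ge0; first exact: ltW.
by apply: le_trans s'D; have := ltW D0; move: s0; rewrite -/s; lra.
Qed.

(** The bound depends on conserved quantities only, so the flight times of a
motion do not tend to zero. *)
Lemma flight_lower y : outgoing y -> 0 < b -> b < a ->
  2 * m / (total y / b + 1 + 2 * m) <= flight y.
Proof.
move=> yo _ ab; have [_ sE /andP[f0 _]] := flight_trig y.
apply: le_trans (sin_le (ltW f0)); rewrite sE.
have A0 := amplitude_gt0 y.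
have sp0 : 0 <= speed y.
  by rewrite /speed addr_ge0// divr_ge0 ?sqr_ge0// ltW.
have sp1 : speed y <= total y / b.
  rewrite /speed /total /dot ler_pdivlMr// mulrDl divfK// -!expr2.
  have h : y.2.1 ^+ 2 / a * b <= y.2.1 ^+ 2.
    by rewrite -mulrA ler_piMr ?sqr_ge0// mulrC ler_pdivrMr// mul1r ltW.
  by have := sqr_ge0 y.1.1; have := sqr_ge0 y.1.2; lra.
rewrite ler_pM2l ?mulr_gt0// lef_pV2 ?posrE//; last first.
  by move: (total y / b) sp1 => q sp1; move: m0 sp0 sp1; lra.
move: (total y / b) sp1 => q sp1.
rewrite -(@ler_pXn2r _ 2)// ?nnegrE ?(ltW A0)//; last by move: m0; lra.
rewrite amplitude_sq.
have h1 : 0 <= (speed y + 1) * m by rewrite mulr_ge0 ?(ltW m0)//; lra.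
apply: (@le_trans _ _ ((speed y + 1 + 2 * m) ^+ 2)); first by lra.
by rewrite ler_pXn2r ?nnegrE//; move: m0; lra.
Qed.

End bounce.

(** * Gluing flights into a billiard motion *)

Section glue.
Context {R : realType} {a b sigma : R}.
Variables (T : nat -> R) (f : nat -> R -> (R * R) * (R * R)).
Variable z : R -> state a b.
Hypothesis T0 : T 0%N = 0.
Hypothesis Tlt : forall n, T n < T n.+1.
Hypothesis Tinf : forall t, exists n, t < T n.
Hypothesis zf : forall n t, T n <= t < T n.+1 -> set_val (z t) = f n t.
Hypothesis f_flow : forall n (t : R),
  is_derive t 1 (fun s => (f n s).1) (f n t).2 /\
  is_derive t 1 (fun s => (f n s).2) (- sigma *: (f n t).1).
Hypothesis f_off : forall n (t : R), T n < t < T n.+1 -> ~ on_ellipse a b (f n t).1.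
Hypothesis f_hit : forall n, on_ellipse a b (f n (T n)).1.
Hypothesis f_pos : forall n, (f n (T n.+1)).1 = (f n.+1 (T n.+1)).1.
Hypothesis f_vel : forall n, reflected a b (f n.+1 (T n.+1)).1
  (f n (T n.+1)).2 (f n.+1 (T n.+1)).2.

Lemma glue_index t : 0 <= t -> exists n, T n <= t < T n.+1.
Proof.
move=> t0; have [n nE nmin] := ex_minnP (Tinf t).
case: n => [|n] in nE nmin *; first by move: nE; rewrite T0 ltNge t0.
exists n; rewrite nE andbT leNgt; apply/negP => /nmin.
by rewrite ltnn.
Qed.

Lemma T_ge0 n : 0 <= T n.
Proof. by elim: n => [|n IH]; [rewrite T0|rewrite ltW// (le_lt_trans IH)]. Qed.

Lemma T_mono n k : (n <= k)%N -> T n <= T k.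
Proof.
move=> /subnKC <-; elim: (k - n)%N => [|i IH]; first by rewrite addn0.
by rewrite addnS (le_trans IH)// ltW.
Qed.

Lemma f_cont n t : f n s @[s --> t] --> f n t.
Proof.
have [d1 d2] := f_flow n t.
have c1 : (f n s).1 @[s --> t] --> (f n t).1.
  apply: (@differentiable_continuous _ _ _ t (fun s => (f n s).1)).
  by apply/derivable1_diffP; case: d1.
have c2 : (f n s).2 @[s --> t] --> (f n t).2.
  apply: (@differentiable_continuous _ _ _ t (fun s => (f n s).2)).
  by apply/derivable1_diffP; case: d2.
rewrite [f n t]surjective_pairing.
have -> : f n = fun s => ((f n s).1, (f n s).2) by apply/funext => s; case: (f n s).
exact: (cvg_pair c1 c2).
Qed.

Lemma glue_right n t : T n <= t < T n.+1 ->
  \forall s \near t^'+, set_val (z s) = f n s.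
Proof.
move=> /andP[nt tn]; near=> s; apply: zf; apply/andP; split.
  by rewrite (le_trans nt)// ltW//; near: s; exact: nbhs_right_gt.
by near: s; exact: nbhs_right_lt.
Unshelve. all: by end_near. Qed.

Lemma glue_left n t : T n < t <= T n.+1 ->
  \forall s \near t^'-, set_val (z s) = f n s.
Proof.
move=> /andP[nt tn]; near=> s; apply: zf; apply/andP; split.
  by apply: ltW; near: s; exact: nbhs_left_gt.
by apply: lt_le_trans tn; near: s; exact: nbhs_left_lt.
Unshelve. all: by end_near. Qed.

Lemma glue_near n t : T n < t < T n.+1 ->
  \forall s \near t, f n s = set_val (z s).
Proof.
move=> /andP[nt tn]; near=> s; apply/esym/zf; apply/andP; split.
  by apply: ltW; near: s; exact: lt_nbhsr.
by near: s; exact: lt_nbhsl.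
Unshelve. all: by end_near. Qed.

Lemma glue_cvg_right t : 0 <= t -> set_val (z s) @[s --> t^'+] --> set_val (z t).
Proof.
move=> /glue_index[n nt]; rewrite (zf nt).
apply: cvg_trans (cvg_at_right_filter (@f_cont n t)); apply: near_eq_cvg.
by apply: filterS (glue_right nt) => s ->.
Qed.

Lemma glue_cvg_left n t : T n < t <= T n.+1 ->
  set_val (z s) @[s --> t^'-] --> f n t.
Proof.
move=> nt; apply: cvg_trans (cvg_at_left_filter (@f_cont n t)).
by apply: near_eq_cvg; apply: filterS (glue_left nt) => s ->.
Qed.

Lemma glue_hit t n : T n <= t < T n.+1 -> on_ellipse a b (pos (z t)) -> t = T n.
Proof.
move=> nt; rewrite /pos (zf nt) => h; apply/eqP; apply: contraT => tn.
case/andP: nt => n1 n2; exfalso; apply: (f_off _ h).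
by rewrite n2 andbT lt_neqAle eq_sym tn.
Qed.

(** On [[T n, T n.+1]] the motion is the flight [f n]; consecutive flights agree
in position at the common end point and their velocities are related by
reflection. *)
Lemma glued_billiard : billiard_motion sigma z.
Proof.
have cvg_left t : 0 < t -> exists2 w, set_val (z s) @[s --> t^'-] --> w &
    w.1 = pos (z t) /\ (on_ellipse a b (pos (z t)) -> reflected a b (pos (z t)) w.2 (vel (z t))).
  move=> t0; have [n /[dup] nt /andP[]] := glue_index (ltW t0).
  rewrite le_eqVlt => /predU1P[tn _|n1 n2].
    case: n => [|n] in nt tn *; first by move: t0; rewrite -tn T0 ltxx.
    exists (f n t); first by apply: glue_cvg_left; rewrite -tn lexx Tlt.
    by rewrite /pos /vel (zf nt) -tn -f_pos; split => // _; rewrite f_pos; exact: f_vel.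
  exists (f n t); first by apply: glue_cvg_left; rewrite n1 ltW.
  split; first by rewrite /pos (zf nt).
  by move=> /(glue_hit nt) tn; move: n1; rewrite tn ltxx.
split.
- apply/continuous_within_itvcyP; split; last first.
    by have := glue_cvg_right (lexx 0); exact: cvg_fst_of.
  move=> t; rewrite in_itv/= andbT => t0; apply/left_right_continuousP; split.
    have [w zw [<- _]] := cvg_left t t0.
    exact (cvg_fst_of _ zw).
  exact (cvg_fst_of _ (glue_cvg_right (ltW t0))).
- by move=> t t0; exact (cvg_snd_of _ (glue_cvg_right t0)).
- move=> t t0 nhit; have [n /[dup] nt /andP[]] := glue_index (ltW t0).
  rewrite le_eqVlt => /predU1P[tn _|n1 n2].
    by exfalso; apply: nhit; rewrite /pos (zf nt) -tn.
  have nr := @glue_near n t ltac:(by rewrite n1).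
  have [d1 d2] := f_flow n t.
  rewrite /pos /vel (zf nt); split.
    by apply: near_eq_is_derive d1; apply: filterS nr => s ->.
  by apply: near_eq_is_derive d2; apply: filterS nr => s ->.
- move=> t t0 hit; have [w zw [_ wr]] := cvg_left t t0.
  by exists w.2; [exact (cvg_snd_of _ zw)|exact: wr].
- move=> S; have [N SN] := Tinf S.
  apply: (@sub_finite_set _ _ [set` [seq T n | n <- iota 0 N]]); last exact: finite_seq.
  move=> t /= [/andP[t0 tS] hit].
  have [n nt] := glue_index t0; have tn := glue_hit nt hit.
  rewrite tn; apply/mapP; exists n => //; rewrite mem_iota/= add0n ltnNge.
  apply/negP => /T_mono; rewrite -tn leNgt => /negP; apply.
  exact: le_lt_trans SN.
Qed.

End glue.

(** * Existence of bouncing motions *)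

Section existence.
Context {R : realType} {a b sigma m : R}.
Hypotheses (b0 : 0 < b) (ab : b < a) (s0 : 0 < sigma) (m0 : 0 < m).

Let a0 : 0 < a. Proof. exact: lt_trans ab. Qed.
Let o := Num.sqrt sigma.
Let o0 : 0 < o. Proof. by rewrite sqrtr_gt0. Qed.
Let on0 : o != 0. Proof. by rewrite gt_eqF. Qed.
Let o2 : o * o = sigma. Proof. by rewrite -expr2 sqr_sqrtr// ltW. Qed.

(** Back from the state [(x, q)] to position and velocity. *)
Definition phys (w : R) (y : (R * R) * (R * R)) : (R * R) * (R * R) :=
  (y.1, w *: y.2).

Lemma is_derive_phase (g : R -> R) (dg w tau t : R) :
  is_derive (w * (t - tau)) 1 g dg ->
  is_derive t 1 (fun s => g (w * (s - tau))) (dg * w).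
Proof.
move=> dgt.
have d2 : is_derive t 1 (fun s => w * (s - tau)) w.
  have h := is_deriveMp (is_derive_const w t)
    (is_deriveBp (is_derive_id t 1) (is_derive_const tau t)).
  by apply: (is_derive_eq h); rewrite /=; ring.
exact: (@is_derive1_comp R g _ t _ _ dgt d2).
Qed.

Lemma rot_flow (y : (R * R) * (R * R)) (tau t : R) :
  is_derive t 1 (fun s => (phys o (rot (o * (s - tau)) y)).1)
    (phys o (rot (o * (t - tau)) y)).2 /\
  is_derive t 1 (fun s => (phys o (rot (o * (s - tau)) y)).2)
    (- sigma *: (phys o (rot (o * (t - tau)) y)).1).
Proof.
have dc := is_derive_phase (is_derive_cos (o * (t - tau))).
have ds := is_derive_phase (is_derive_sin (o * (t - tau))).
rewrite !is_derive_pairP /phys /rot /= /GRing.scale/= -o2; split; split.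
- by eapply is_derive_eq; [derive_poly|rewrite /GRing.scale /=; ring].
- by eapply is_derive_eq; [derive_poly|rewrite /GRing.scale /=; ring].
- have dns : is_derive t 1 (fun s => - sin (o * (s - tau))) (- (cos (o * (t - tau)) * o)).
    exact: is_deriveN.
  by eapply is_derive_eq; [derive_poly|rewrite /GRing.scale /=; ring].
- have dns : is_derive t 1 (fun s => - sin (o * (s - tau))) (- (cos (o * (t - tau)) * o)).
    exact: is_deriveN.
  by eapply is_derive_eq; [derive_poly|rewrite /GRing.scale /=; ring].
Qed.

Variable y0 : (R * R) * (R * R).
Hypothesis y0o : outgoing (a := a) (b := b) m y0.

Let Y n := iter n (next (a := a) (b := b) m) y0.

Lemma iter_outgoing n : outgoing (a := a) (b := b) m (Y n).
Proof. by elim: n => [//|n IH]; exact: next_outgoing. Qed.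

Let T n : R := \sum_(k < n) flight (a := a) (b := b) m (Y k) / o.

Let TS n : T n.+1 = T n + flight (a := a) (b := b) m (Y n) / o.
Proof. by rewrite /T big_ord_recr. Qed.

Lemma total_iter n : total (Y n) = total y0.
Proof.
by elim: n => [//|n IH]; rewrite /Y /= total_next//; exact: iter_outgoing.
Qed.

Let dt := 2 * m / (total y0 / b + 1 + 2 * m) / o.
Let dt0 : 0 < dt.
Proof.
have t0 : 0 <= total y0 / b.
  rewrite /total /dot divr_ge0//; last exact: ltW.
  by rewrite -!expr2; apply: addr_ge0; apply: addr_ge0; exact: sqr_ge0.
by rewrite divr_gt0// divr_gt0 ?mulr_gt0//; move: m0; lra.
Qed.

Let T_lower n : n%:R * dt <= T n.
Proof.
elim: n => [|n IH]; first by rewrite mul0r /T big_ord0.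
rewrite TS -natr1 mulrDl mul1r lerD// /dt ler_pM2r ?invr_gt0//.
rewrite -(total_iter n); apply: flight_lower => //; exact: iter_outgoing.
Qed.

Lemma bouncing_motion : exists2 z : R -> state a b, billiard_motion sigma z &
  exists2 S : nat -> R, S 0%N = 0 & forall n, 0 <= S n /\
    set_val (z (S n)) = phys o (iter n (next (a := a) (b := b) m) y0).
Proof.
have T0 : T 0%N = 0 by rewrite /T big_ord0.
have fl n := flight_trig (a := a) (b := b) m0 (Y n).
have Tlt n : T n < T n.+1.
  by rewrite TS ltrDl divr_gt0//; have [_ _ /andP[]] := fl n.
have Tinf t : exists n, t < T n.
  exists (Num.Def.archi_bound (`|t| / dt)); apply: lt_le_trans (T_lower _).
  rewrite -ltr_pdivrMr//; apply: le_lt_trans (archi_boundP _); last by rewrite divr_ge0// ltW.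
  by rewrite ler_pM2r ?invr_gt0// ler_norm.
pose f n t := phys o (rot (o * (t - T n)) (Y n)).
have oT n : o * (T n.+1 - T n) = flight (a := a) (b := b) m (Y n).
  by rewrite TS addrAC subrr add0r mulrC divfK.
have range n t : T n < t < T n.+1 -> 0 < o * (t - T n) < flight (a := a) (b := b) m (Y n).
  move=> /andP[n1 n2]; rewrite mulr_gt0 ?subr_gt0//= -oT ltr_pM2l//.
  by rewrite ltrD2r.
have f_off n t : T n < t < T n.+1 -> ~ on_ellipse a b (f n t).1.
  move=> /range h hit.
  by have := flight_inside a0 b0 m0 (iter_outgoing n) h; rewrite hit ltxx.
have fT n : f n (T n) = phys o (Y n) by rewrite /f subrr mulr0 rot0.
have fin n t : T n <= t < T n.+1 -> f n t \in inside a b.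
  move=> /andP[n1 n2]; apply/mem_set.
  move: n1; rewrite le_eqVlt => /predU1P[<-|n1].
    by rewrite fT /inside/=; have [+ _] := iter_outgoing n; rewrite /on_ellipse => ->.
  apply: ltW; apply: (flight_inside a0 b0 m0 (iter_outgoing n)).
  by apply: range; rewrite n1.
have T0in : T 0%N <= 0 < T 1%N by rewrite T0 lexx -{1}T0 Tlt.
pose z0 : state a b := exist (fun w => w \in inside a b) _ (fin 0%N 0 T0in).
pose z t : state a b := insubd z0 (f (xget 0%N [set n | T n <= t < T n.+1]) t).
have zf n t : T n <= t < T n.+1 -> set_val (z t) = f n t.
  move=> nt; rewrite /z; case: xgetP => [k _ /= kt|/(_ n)//].
  have -> : k = n.
    case/andP: nt => n1 n2; case/andP: kt => k1 k2.
    case: (ltngtP k n) => // h; have := T_mono Tlt h.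
      by rewrite leNgt (le_lt_trans n1).
    by rewrite leNgt (le_lt_trans k1).
  by rewrite set_valE insubdK//; exact (fin _ _ nt).
exists z.
  apply: (@glued_billiard R a b sigma T f z T0 Tlt Tinf zf) => //.
  - by move=> n t; exact: rot_flow.
  - by move=> n; rewrite fT; have [] := iter_outgoing n.
  - by move=> n; rewrite (fT n.+1) /f oT.
  - move=> n; rewrite (fT n.+1) /f oT; apply: next_reflected => //; exact: iter_outgoing.
exists T => // n; split; first exact: T_ge0.
have nT : T n <= T n < T n.+1 by rewrite lexx Tlt.
by rewrite (zf n _ nT) fT.
Qed.

End existence.

(** * Instability along the x-axis *)

Section unstable.
Context {R : realType} {a b sigma : R}.
Hypotheses (b0 : 0 < b) (ab : b < a) (s0 : 0 < sigma).

Let a0 : 0 < a. Proof. exact: lt_trans ab. Qed.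
Let an0 : a != 0. Proof. by rewrite gt_eqF. Qed.
Let bn0 : b != 0. Proof. by rewrite gt_eqF. Qed.
Let al := Num.sqrt a.
Let be := Num.sqrt b.
Let al0 : 0 < al. Proof. by rewrite sqrtr_gt0. Qed.
Let be0 : 0 < be. Proof. by rewrite sqrtr_gt0. Qed.
Let aE : al ^+ 2 = a. Proof. by rewrite sqr_sqrtr// ltW. Qed.
Let o := Num.sqrt sigma.
Let o0 : 0 < o. Proof. by rewrite sqrtr_gt0. Qed.
Let on0 : o != 0. Proof. by rewrite gt_eqF. Qed.

Let eta := b / (2 * a).
Let eta0 : 0 < eta. Proof. by rewrite divr_gt0// mulr_gt0. Qed.
Let eta2 : eta <= 2^-1.
Proof. by rewrite ler_pdivrMr ?mulr_gt0// mulrA mulVf// mul1r ltW. Qed.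

(** A condition on phase points: position and tangential component are not
changed by reflections.  The constants are those of [slope_small] and
[rotation_growth]. *)
Definition near_axis (z : state a b) : Prop :=
  `|(pos z).2| < eta * be /\
  `|tangential a b (set_val z)| < o * (b / 2) / (al * be).

(** By [next_growth] the distance of the impact points from the axis grows at
least linearly with the number of bounces. *)
Lemma tilted_escape (m l : R) (y0 : (R * R) * (R * R)) : 0 < m -> 0 < l ->
  outgoing (a := a) (b := b) m y0 -> 0 < y0.1.1 -> y0.1.2 = 0 ->
  slope (a := a) (b := b) y0 <= - l ->
  (forall n, let y := iter n (next (a := a) (b := b) m) y0 in
     `|y.1.2| < eta * be /\
     `|tangential a b (phys o y)| < o * (b / 2) / (al * be)) -> False.
Proof.
move=> m0 l0 y0o x0 x20 jl stay.
pose Y n := iter n (next (a := a) (b := b) m) y0.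
have Yo n : outgoing (a := a) (b := b) m (Y n) by exact: iter_outgoing.
have Yu n : `|(Y n).1.2 / be| < eta.
  by rewrite normrM [`|be^-1|]gtr0_norm ?invr_gt0// ltr_pdivrMr//; have [] := stay n.
have Yj n : slope (a := a) (b := b) (Y n) ^+ 2 <= 1 + m ^+ 2.
  apply: (slope_small a0 b0 m0 (Yo n) ab erefl (Yu n)).
  have -> : tangential a b (Y n) = tangential a b (phys o (Y n)) / o.
    by rewrite /tangential /phys /= /GRing.scale/=; field; rewrite on0 an0 bn0.
  rewrite mulrA normrM [`|o^-1|]gtr0_norm ?invr_gt0// ltr_pdivrMr//.
  rewrite normrM [`|_ * _|]gtr0_norm; last by rewrite mulr_gt0.
  rewrite mulrC -ltr_pdivlMr; last by rewrite mulr_gt0.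
  by rewrite [_ * o]mulrC; have [] := stay n.
pose d := m * l / (1 + m ^+ 2) / 4.
have d0 : 0 < d.
  rewrite divr_gt0// divr_gt0// ?mulr_gt0//; have := sqr_ge0 m; lra.
have grow n : exists eps, [/\ eps * eps = 1, 0 < eps * ((Y n).1.1 / al),
    n%:R * d <= eps * ((Y n).1.2 / be) & slope (a := a) (b := b) (Y n) <= - l].
  elim: n => [|n [eps [e2 c0 s1 jn]]].
    exists 1; split => //; rewrite ?mul1r//=; first by rewrite divr_gt0.
    by rewrite x20 !mul0r.
  have sn0 : 0 <= eps * ((Y n).1.2 / be).
    by apply: le_trans s1; rewrite mulr_ge0// ltW.
  have [c' s' j'] := next_growth a0 b0 m0 (Yo n) ab l0 e2 jn (Yj n) eta2 c0 sn0 (Yu n) (Yu n.+1).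
  exists (- eps); split => //; first by rewrite mulrNN.
  rewrite -natr1 mulrDl mul1r; apply: le_trans s'.
  by rewrite lerD2r.
have [eps [e2 _ + _]] := grow (Num.Def.archi_bound (eta / d)).
have epsn : `|eps| = 1.
  by apply/eqP; rewrite -(@eqrXn2 _ 2)// real_normK ?num_real// expr1n expr2 e2.
apply/negP; rewrite -ltNge; apply: (@lt_trans _ _ eta).
  by apply: le_lt_trans (ler_norm _) _; rewrite normrM epsn mul1r.
by rewrite -ltr_pdivrMr//; apply: archi_boundP; rewrite divr_ge0// ltW.
Qed.

(** Every neighbourhood of the orbit contains the state [g d], at the vertex
[(sqrt a, 0)], for small [d > 0]; it is slightly tilted and slightly faster
than the orbit.  The excess of speed gives a positive normal part also when
the orbit has the least possible energy and reaches the vertex with zero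
velocity. *)
Theorem x_axis_unstable e (z : R -> state a b) : x_axis_motion sigma e z ->
  ~ orbitally_stable sigma (phase_orbit z).
Proof.
move=> [bz ze elo xi] stable.
have e0 : 0 < e by apply: lt_le_trans elo; rewrite divr_gt0// mulr_gt0.
have [vi visit] := @axis_visits R a b sigma a0 b0 s0 false e z bz ze e0 xi.
pose kap := o * (b / 2) / (al * be).
have kap0 : 0 < kap by rewrite divr_gt0// ?mulr_gt0// divr_gt0.
pose A : set (state a b) := [set w | near_axis w].
have oA : open A.
  rewrite (_ : A = (fun w : state a b => `|(pos w).2|) @^-1` [set x | x < eta * be]
     `&` (fun w : state a b => `|tangential a b (set_val w)|) @^-1` [set x | x < kap])//.
  have c1 : continuous (fun w : state a b => `|(pos w).2|).
    apply: (@comp_set_val_continuous R a b (fun y => `|y.1.2|)) => y.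
    by have [_ c2 _ _] := coord_continuous y; apply: cvg_norm.
  have c2 : continuous (fun w : state a b => `|tangential a b (set_val w)|).
    apply: (@comp_set_val_continuous R a b (fun y => `|tangential a b y|)) => y.
    by apply: cvg_norm; exact: tangential_continuous.
  apply: openI; (apply: open_comp; last exact: open_lt) => w _.
    exact: c1.
  exact: c2.
have sA : saturated A.
  move=> z1 z2 z12; rewrite /A/= /near_axis.
  rewrite (invariant_set_val (@tangential_reflection R a b) z12).
  by case: z12 => [->//|[-> _ _]].
pose U := @M_B R sigma a b `&` @phase R a b @` A.
have nU : nbhs_in_M_B sigma (phase_orbit z) U.
  split; first by move=> y [].
  move=> y [t]; rewrite /= in_itv/= andbT => t0 <-.
  have At : A (z t).
    have x2 : (pos (z t)).2 = 0 by exact: xi.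
    have v2 : (vel (z t)).2 = 0 by exact: vi.
    split; first by rewrite x2 normr0 mulr_gt0.
    rewrite /tangential -/(pos (z t)) -/(vel (z t)) x2 v2 mulr0 !mul0r subr0 normr0.
    exact: kap0.
  by apply: filterS (nbhs_phase_image oA sA At) => y' Ay' My'.
have [V [VM nV] VU] := stable U nU.
pose ve := Num.sqrt (2 * e - sigma * a).
have ve2 : ve ^+ 2 = 2 * e - sigma * a by rewrite sqr_sqrtr//; lra.
have ve0 : 0 <= ve by rewrite sqrtr_ge0.
pose g (d : R) : (R * R) * (R * R) := ((al, 0), (- ve - d, - d)).
have gin d : g d \in inside a b.
  by apply/mem_set; rewrite /inside/= aE divff// expr0n mul0r addr0.
pose zs : state a b := exist (fun w => w \in inside a b) _ (gin 0).
have zsE : set_val zs = g 0 by [].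
have gzs : phase_orbit z (phase zs).
  apply: visit; [by rewrite /pos zsE|by rewrite /vel zsE /= oppr0|].
  rewrite energyE zsE /energy_fun /dot /= -!expr2 aE subr0 sqrrN ve2.
  by field.
have [W [oW Wzs] WV] : exists2 W : set ((R * R) * (R * R)), open W /\ W (g 0) &
    forall w : state a b, W (set_val w) -> M_B sigma (phase w) -> V (phase w).
  have := nV _ gzs => /(@phase_continuous R a b zs).
  rewrite /= nbhs_simpl/= nbhsE => -[W' [/open_stateP[W oW W'E] W'z] W'V].
  exists W; first by split => //; rewrite -zsE; move: W'z; rewrite W'E.
  by move=> w Ww; apply: W'V; rewrite W'E.
have gc : g d @[d --> 0^'+] --> g 0.
  have gd (c k : R) : c - k * d @[d --> (0 : R)^'+] --> c - k * 0.
    apply: cvg_at_right_filter; apply: cvgB; first exact: cvg_cst.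
    by apply: cvgM; [exact: cvg_cst|exact: cvg_id].
  have g1 := gd (- ve) 1; have g2 := gd 0 1.
  have gE : g = fun d => ((al, 0), (- ve - 1 * d, 0 - 1 * d)).
    by apply/funext => d; rewrite /g mul1r sub0r.
  rewrite gE.
  have cc : (fun=> (al, 0) : R * R) @ (0 : R)^'+ --> ((al, 0) : R * R) by exact: cvg_cst.
  exact (cvg_pair cc (cvg_pair g1 g2)).
have [d d0 Wd] : exists2 d, 0 < d & W (g d).
  have : \forall d \near (0 : R)^'+, 0 < d /\ W (g d).
    near=> d; split; first by near: d; exact: nbhs_right_gt.
    by near: d; apply: gc; exact: open_nbhs_nbhs.
  by move=> /filter_ex[d []]; exists d.
pose y0 : (R * R) * (R * R) := ((al, 0), ((- ve - d) / o, - d / o)).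
pose m := (ve + d) / (o * al).
have m0 : 0 < m by rewrite divr_gt0 ?mulr_gt0// ltr_wpDl.
have gy0 : phys o y0 = g d.
  rewrite /phys /y0 /g /= /GRing.scale/=.
  by congr (_, (_, _)); rewrite /GRing.scale/=; field.
have aln : al != 0 by rewrite gt_eqF.
have ben : be != 0 by rewrite gt_eqF.
have y0o : outgoing (a := a) (b := b) m y0.
  split; first by rewrite /on_ellipse/= aE divff// expr0n mul0r addr0.
  rewrite /normal_part /= /m -aE; field.
  by rewrite aln on0 bn0.
have [zz bzz [S S0 Sz]] := bouncing_motion b0 ab s0 m0 y0o.
have zz0 : set_val (zz 0) = g d by rewrite -S0; have [_ ->] := Sz 0%N.
have Vz : V (phase (zz 0)).
  apply: WV; first by rewrite zz0.
  exists (zz 0) => //=; rewrite p_integralE zz0 p_fun0_ellipse//.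
    rewrite oppr_le0; apply: mulr_ge0; last exact: sqr_ge0.
    by rewrite mulr_ge0// ltW.
  by rewrite /on_ellipse/= aE divff// expr0n mul0r addr0.
apply: (@tilted_escape m (d / (o * be)) y0) => //.
- by rewrite divr_gt0// mulr_gt0.
- have -> : slope (a := a) (b := b) y0 = - (d / (o * be)); last exact: lexx.
  by rewrite /slope /angular /= -/al -/be; field; rewrite on0 aln ben.
move=> n y; have [Sn0 Sn] := Sz n.
have [_ [w Aw /phaseP ww]] := VU zz (or_introl bzz) Vz (S n) Sn0.
have := sA _ _ ww Aw; rewrite /A/= /near_axis /pos Sn.
by [].
Unshelve. all: by end_near. Qed.

End unstable.

Theorem corollary3p1 (R : realType) (a b sigma : R)
    (hb : 0 < b) (hab : b < a) (hsigma : 0 < sigma) :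
  [/\ forall (e : R) (z : R -> state a b), y_axis_motion sigma e z ->
        orbitally_stable sigma (phase_orbit z),
      forall (e : R) (z : R -> state a b), limit_motion sigma e z ->
        orbitally_stable sigma (phase_orbit z) &
      forall (e : R) (z : R -> state a b), x_axis_motion sigma e z ->
        ~ orbitally_stable sigma (phase_orbit z)].
Proof.
split=> e z.
- exact: y_axis_stable.
- exact: limit_stable.
- exact: x_axis_unstable.
Qed.
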